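(* Let $G$ be a countable group. Then there exist a simple group $S$ and an injective homomorphism $\varphi : G \to S$ such that: (i) for all $p, q \in \{2, 3, \dots\} \cup \{\infty\}$ with $q \geq 3$, there exist elements $x, y \in S$ of order $p$ and $q$, respectively, such that $S$ is generated by $\{x, y\}$; and (ii) if $|G| \geq 3$, then for every $p \in \{2, 3, \dots\} \cup \{\infty\}$ there exists an element $z \in S$ of order $p$ such that $S$ is generated by $\varphi(G) \cup \{z\}$.
   Context: Countable means finite or countably infinite. The condition $q \geq 3$ includes $q = \infty$, and an element of order $\infty$ is an element of infinite order. The group $S$ and the embedding $\varphi$ depend only on $G$, not on $p$ and $q$. *)

(* Defs.v *)
From HB Require Import structures.
From mathcomp Require Import all_boot.
From mathcomp Require Import boolp classical_sets functions cardinality.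

Set Implicit Arguments.
Unset Strict Implicit.
Unset Printing Implicit Defensive.

Local Open Scope group_scope.
Local Open Scope classical_set_scope.

Definition subgroup (G : groupType) (H : set G) : Prop := group_closed (mem H).

Definition normal_subgroup (G : groupType) (N : set G) : Prop :=
  subgroup N /\ forall x g : G, N x -> N (x ^ g).

(* The trivial group is not simple. *)
Definition simple_group (G : groupType) : Prop :=
  [set: G] <> [set 1] /\
  forall N : set G, normal_subgroup N -> N = [set 1] \/ N = [set: G].

Definition generated (G : groupType) (A : set G) : set G :=
  smallest (@subgroup G) A.

(* Orders range over the positive integers and infinity: [Some n] stands for
   the integer n and [None] for infinity. *)
Definition ext_order : Type := option nat.

Definition ext_ge (p : ext_order) (k : nat) : Prop :=
  if p is Some n then (k <= n)%N else True.

Definition has_order (G : groupType) (x : G) (p : ext_order) : Prop :=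
  match p with
  | Some n => [/\ (0 < n)%N, x ^+ n = 1
                & forall m : nat, (0 < m < n)%N -> x ^+ m <> 1]
  | None => forall m : nat, (0 < m)%N -> x ^+ m <> 1
  end.

(* Main.v *)
Require Import Defs.
From HB Require Import structures.
From mathcomp Require Import all_boot zify generic_quotient.
From mathcomp Require Import boolp classical_sets functions cardinality.
From mathcomp Require Import ssralg ssrnum poly algC cyclotomic.

Set Implicit Arguments.
Unset Strict Implicit.
Unset Printing Implicit Defensive.

(** Let [Gam] be the product of [G] and the multiplicative group of nonzero
algebraic numbers: it is countable, contains [G], and has elements of every
order.  Take two copies of [Gam], the two sides, and impose on their free
product one relation for each choice of a nontrivial [x] on one side, of two
distinct nontrivial [b1], [b2] on the other side, and of a nontrivial letter
[g] on either side: [g] equals a long word in [x], [b1], [b2].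

In every quotient satisfying these relations, [x], [b1], [b2] as above generate
everything ([model_gen]).  Hence if one nontrivial letter [x] dies, so does the
whole quotient ([model_kill]): taking [b1], [b2] to be [c], [c ^+ 2] for [c] of
order 3, the quotient is generated by the image of [c], so every letter has
cube 1; taking [c] of order 5, every letter has fifth power 1 too.

By Zorn's lemma there is a maximal quotient in which a fixed letter survives.
It is simple, because a nontrivial normal subgroup kills that letter, hence
everything; and both copies of [Gam] embed in it, since otherwise some
nontrivial letter dies ([simple_quotient]).  In this group, (i) is
the case of [x] of order [p] on one side and [b1], [b2] equal to [y], [y ^+ 2]
for [y] of order at least 3 on the other side; (ii) is the case of [b1], [b2]
taken from the copy of [G].

It remains to see that the relations do not kill the fixed letter, which is
small cancellation theory over a free product.  In a relator the letters [b1]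
come in runs separated by single letters [b2], and all run lengths, over all
relators, are different, which is possible because [Gam] is countable; so two
relators sharing a stretch of 1/32 of their length are the same relator, read
from the same place ([relator_small_cancellation]).  For such relators
[sc_action] constructs a set on which each side acts freely and every relator
acts trivially.  The set grows in stages from one point at which nothing is
defined: wherever a relator cannot be read through, an arc of new points is
glued in that completes it to a loop.  The invariant is that a path reading
1/8 of a relator lies on a loop labelled by that relator.  It is kept
([close_invariant]) because a path among the new points follows arcs and can
pass from one arc to another only within 1/32 of their ends; two such passages
are nearly a whole arc apart, too far for a path that does not follow a loop. *)

(** * Words in two copies of a group, and partial actions *)
Section Words.
Variable Gam : groupType.
Definition letter : Type := (bool * Gam)%type.
Definition word : Type := seq letter.
Definition linv (l : letter) : letter := (l.1, l.2^-1)%g.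
Definition winv (w : word) : word := rev (map linv w).
Definition l0 : letter := (true, 1%g).

Lemma linvK : involutive linv.
Proof. by case=> s a; rewrite /linv /= invgK. Qed.
Lemma winvK : involutive winv.
Proof.
by move=> w; rewrite /winv map_rev revK -map_comp (eq_map (g := id)) ?map_id // => l; exact: linvK.
Qed.
Lemma winv_cat u v : winv (u ++ v) = winv v ++ winv u.
Proof. by rewrite /winv map_cat rev_cat. Qed.
Lemma size_winv w : size (winv w) = size w.
Proof. by rewrite size_rev size_map. Qed.
Lemma nth_winv w i : i < size w ->
  nth l0 (winv w) i = linv (nth l0 w (size w - i.+1)).
Proof.
move=> h; rewrite nth_rev size_map // (nth_map l0) //; lia.
Qed.

Variable U : Type.
Implicit Type st : U -> letter -> U -> Prop.

(** A labelled graph on [U] is a relation [st]: [st x l y] is an edge from [x]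
to [y] with label [l]. *)
Fixpoint run st (x : U) (w : word) (y : U) : Prop :=
  if w is l :: w' then exists2 z, st x l z & run st z w' y else x = y.

Lemma run_cat st x u v y :
  run st x (u ++ v) y <-> exists2 z, run st x u z & run st z v y.
Proof.
elim: u x => [|l u IH] x /=; first by split=> [h|[z -> //]]; exists x.
split=> [[z h /IH[t h1 h2]]|[t [z h h1] h2]]; first by exists t => //; exists z.
by exists z => //; apply/IH; exists t.
Qed.

Lemma run_mono st st' x w y : (forall a l b, st a l b -> st' a l b) ->
  run st x w y -> run st' x w y.
Proof.
by move=> h; elim: w x => //= l w IH x [z /h hz /IH hw]; exists z.
Qed.

(** At each point, each side is either undefined or belongs to a regular orbit
of its copy of the group ([act_tot], [act_free]): a side may act on a part of
the points only, but then it acts freely. *)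
Record action st : Prop := Action {
  act_det : forall x l y y', st x l y -> st x l y' -> y = y';
  act_mul : forall x s a y b z, st x (s, a) y -> st y (s, b) z -> st x (s, a * b)%g z;
  act_tot : forall x s a y b, st x (s, a) y -> exists z, st x (s, b) z;
  act_one : forall x s y, st x (s, 1%g) y -> y = x;
  act_inv : forall x s a y, st x (s, a) y -> st y (s, a^-1)%g x;
  act_free : forall x s a, st x (s, a) x -> a = 1%g }.

Lemma run_det st x w y y' : action st -> run st x w y -> run st x w y' -> y = y'.
Proof.
move=> A; elim: w x => [|l w IH] x /=; first by move=> <-.
by move=> [z h1 h2] [t h3 h4]; move: h4; rewrite -(act_det A h1 h3); exact: IH.
Qed.

Lemma run_winv st x w y : action st -> run st x w y -> run st y (winv w) x.
Proof.
move=> A; elim: w x => [|l w IH] x /=; first by [].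
move=> [z h1 h2]; rewrite /winv /= rev_cons -cats1; apply/run_cat.
by exists z; [exact: IH | exists x => //; case: l h1 => s a; exact: act_inv].
Qed.

Lemma run_take st x w y k : run st x w y -> exists z, run st x (take k w) z.
Proof. by rewrite -{1}(cat_take_drop k w) => /run_cat[z h _]; exists z. Qed.

(** Whether a loop is closed does not depend on the point of it from which it is
read; with [closed_unrot] this lets relators be rotated freely. *)
Lemma closed_rot st x r k y : action st -> run st x (take k r) y ->
  run st x r x -> run st y (rot k r) y.
Proof.
move=> A h; rewrite -{1}(cat_take_drop k r) => /run_cat[z h1 h2].
rewrite -(run_det A h h1) in h2; apply/run_cat; by exists x.
Qed.

Lemma closed_unrot st x r k y : action st -> run st x (take k r) y ->
  run st y (rot k r) y -> run st x r x.
Proof.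
move=> A h /run_cat[z h1 h2].
rewrite -{1}(cat_take_drop k r); apply/run_cat; exists y => //.
suff -> : x = z by [].
by have := run_det A (run_winv A h) (run_winv A h2).
Qed.

Lemma closed_winv st x r : action st -> run st x r x <-> run st x (winv r) x.
Proof. by move=> A; split=> /(run_winv A) //; rewrite winvK. Qed.

Lemma last_before (P : nat -> Prop) n : P 0 -> ~ P n ->
  exists2 k, k < n & P k /\ ~ P k.+1.
Proof.
move=> h0; elim: n => // n IH hn.
case: (pselect (P n)) => h; first by exists n.
by have [k kn hk] := IH h; exists k => //; exact: ltnW.
Qed.
End Words.

(** * Small cancellation and the gluing of arcs *)

(** The relators [R] are closed under rotation and inversion; [pos] selects one
of the two orientations of each cyclic relator.  It is what breaks the symmetry
between the two ends of an arc below.  [sc_piece] is the small cancellation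
condition: distinct relators have no common beginning as long as 1/32 of one of
them. *)
Record small_cancellation (Gam : groupType) (R : word Gam -> Prop)
    (pos : word Gam -> bool) : Prop := SmallCancellation {
  sc_size : forall r, R r -> 64 <= size r;
  sc_rot : forall n r, R r -> R (rot n r);
  sc_inv : forall r, R r -> R (winv r);
  sc_posrot : forall n r, R r -> pos (rot n r) = pos r;
  sc_posinv : forall r, R r -> pos (winv r) = ~~ pos r;
  sc_alt : forall r i, R r -> i.+1 < size r ->
    (nth (l0 Gam) r i.+1).1 = ~~ (nth (l0 Gam) r i).1;
  sc_neq1 : forall r i, R r -> i < size r -> (nth (l0 Gam) r i).2 <> 1%g;
  sc_piece : forall r r' k, R r -> R r' -> k <= size r -> size r <= 32 * k ->
    take k r = take k r' -> r = r' }.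

(** One stage of the construction.  [st] is the graph obtained so far, on the
points [D]; [Inv] is the invariant to be kept; and [nd x u] is a supply of new
points, named by a point and a word. *)
Section Loops.
Variables (Gam : groupType) (R : word Gam -> Prop) (pos : word Gam -> bool).
Hypothesis SC : small_cancellation R pos.
Variables (U : Type) (D : U -> Prop) (st : U -> letter Gam -> U -> Prop).
Hypothesis Ast : action st.
Hypothesis Dst : forall x l y, st x l y -> D x.
Hypothesis Inv : forall x y r k, R r -> run st x (take k r) y ->
  size r <= 8 * k -> run st x r x.
Variable nd : U -> word Gam -> U.
Hypothesis nd_inj : forall x y u v, nd x u = nd y v -> x = y /\ u = v.
Hypothesis nd_fresh : forall x u, ~ D (nd x u).

Local Notation l0 := (l0 Gam).
Local Notation word := (word Gam).

(** A relator that [st] fails to close: read from [exit], it is undefined at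
once, and its last letters lead in [st] from [entry] to [exit].  The first
[arc_len] letters are the arc to be added, from [exit] to [entry]; by
[exit_undef] and [entry_undef] the graph does not already contain its beginning
or its end. *)
Record loop := Loop { exit : U; loop_word : word; entry : U; arc_len : nat }.

Record is_loop (p : loop) : Prop := IsLoop {
  exit_D : D (exit p);
  entry_D : D (entry p);
  loop_word_R : R (loop_word p);
  arc_len_le : arc_len p <= size (loop_word p);
  arc_len_gt : 0 < arc_len p;
  tail_run : run st (entry p) (drop (arc_len p) (loop_word p)) (exit p);
  exit_undef : forall y, ~ st (exit p) (nth l0 (loop_word p) 0) y;
  entry_undef : forall y, ~ st (entry p) (linv (nth l0 (loop_word p) (arc_len p).-1)) y }.

(** The same loop travelled backwards. *)
Definition loop_bar (p : loop) : loop :=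
  Loop (entry p) (winv (take (arc_len p) (loop_word p)) ++ winv (drop (arc_len p) (loop_word
    p))) (exit p) (arc_len p).

Lemma loop_bar_rot p : arc_len p <= size (loop_word p) ->
  loop_word (loop_bar p) = rot (size (loop_word p) - arc_len p) (winv (loop_word p)).
Proof.
move=> h; rewrite -{2}(cat_take_drop (arc_len p) (loop_word p)) winv_cat /=.
rewrite -size_drop -(size_winv (drop (arc_len p) (loop_word p))).
by rewrite rot_size_cat.
Qed.

Lemma size_loop_bar p : size (loop_word (loop_bar p)) = size (loop_word p).
Proof. by rewrite /= size_cat !size_winv -size_cat cat_take_drop. Qed.

Lemma loop_barK p : arc_len p <= size (loop_word p) -> loop_bar (loop_bar p) = p.
Proof.
move=> h; rewrite /loop_bar /= take_size_cat ?drop_size_cat ?size_winv ?size_takel //.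
by rewrite !winvK cat_take_drop; case: p {h}.
Qed.

Lemma nth_loop_bar p i : arc_len p <= size (loop_word p) -> i < arc_len p ->
  nth l0 (loop_word (loop_bar p)) i = linv (nth l0 (loop_word p) (arc_len p - i.+1)).
Proof.
move=> h hi; rewrite /= nth_cat size_winv size_takel // hi nth_winv ?size_takel //.
by rewrite nth_take //; lia.
Qed.

Lemma is_loop_bar p : is_loop p -> is_loop (loop_bar p).
Proof.
move=> [h1 h2 h3 h4 h5 h6 h7 h8]; split => //.
- by rewrite loop_bar_rot //; apply: (sc_rot SC); apply: (sc_inv SC).
- by rewrite size_loop_bar.
- by rewrite /= drop_size_cat ?size_winv ?size_takel //; exact: run_winv.
- by rewrite nth_loop_bar //= -[arc_len p - 1]/(arc_len p - 1) subn1.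
- rewrite [arc_len (loop_bar p)]/= nth_loop_bar //; last by lia.
  by rewrite linvK prednK // subnn.
Qed.

Lemma pos_bar p : is_loop p -> pos (loop_word (loop_bar p)) = ~~ pos (loop_word p).
Proof.
move=> h; rewrite loop_bar_rot ?(sc_posrot SC) ?(sc_posinv SC) //; last exact: arc_len_le.
- exact: loop_word_R. 
- by apply: (sc_inv SC); exact: loop_word_R.
Qed.

(** The part of the relator present in [st] is less than 1/8 of it, for
otherwise [Inv] would close the relator. *)
Lemma arc_len_large p : is_loop p -> 8 * (size (loop_word p) - arc_len p) < size (loop_word p).
Proof.
move=> h; rewrite ltnNge; apply/negP => le.
have hr : run st (entry p) (take (size (loop_word p) - arc_len p) (rot (arc_len p) (loop_word
  p))) (exit p).
  rewrite /rot take_size_cat ?size_drop //; exact: tail_run.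
have := Inv (sc_rot SC _ (loop_word_R h)) hr; rewrite size_rot => /(_ le).
rewrite /rot => /run_cat[z /(run_det Ast (tail_run h)) <-].
have : 0 < size (loop_word p) by exact: leq_trans (arc_len_gt h) (arc_len_le h).
have := arc_len_gt h; have := exit_undef h; case: (loop_word p) => //= l w hl.
by case: (arc_len p) => //= n _ _ [y /hl].
Qed.

Lemma st_undef x s a b y : st x (s, a) y -> ~ (forall y, ~ st x (s, b) y).
Proof. by move=> h1 h2; have [z /h2] := act_tot Ast b h1. Qed.

(** If the arc of [q] were longer than that of [p], the tail of [p] would pass through [entry q]
by an edge that is undefined there. *)
Lemma loop_uniq p q : is_loop p -> is_loop q -> exit p = exit q -> loop_word p = loop_word q ->
  p = q.
Proof.
wlog le : p q / arc_len p <= arc_len q.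
  move=> H hp hq ea er; case: (leqP (arc_len p) (arc_len q)) => [/H|/ltnW/H]; first exact.
  by move=> /(_ hq hp (esym ea) (esym er)) ->.
move=> hp hq ea er.
have := tail_run hp; have := tail_run hq; rewrite -ea -er => hq1.
rewrite -(cat_take_drop (arc_len q - arc_len p) (drop _ _)) drop_drop subnK //.
case/run_cat => z h1 h2.
have ez : z = entry q := run_det Ast (run_winv Ast h2) (run_winv Ast hq1).
case: (leqP (arc_len q) (arc_len p)) => le2.
  have eM : arc_len p = arc_len q by lia.
  move: h1; rewrite eM subnn take0 /= => eb.
  by move: ea er eM eb ez; clear; case: p => ? ? ? ?; case: q => ? ? ? ? /= -> -> -> -> ->.
exfalso; have hs := arc_len_le hq; rewrite -er in hs.
move: h1; have -> : arc_len q - arc_len p = (arc_len q).-1 - arc_len p + 1 by lia.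
rewrite takeD => /run_cat[t _].
rewrite drop_drop subnK; last by lia.
rewrite (drop_nth l0); last by lia.
rewrite /= take0 => -[t' h' /= et]; have := entry_undef hq.
rewrite -er -ez -et; case: (nth l0 _ _) h' => s a /(act_inv Ast) h1.
by move=> /(_ t).
Qed.

(** The new point reached from [x] by the letters [w]: a point is named by the
path leading to it, so that arcs with a common beginning share it. *)
Definition node (x : U) (w : word) : U := if w is [::] then x else nd x w.

Lemma node_inj x y u v : D x -> D y -> node x u = node y v -> x = y /\ u = v.
Proof.
case: u => [|a u]; case: v => [|b v] //= dx dy e.
- by case: (@nd_fresh y (b :: v)); rewrite -e.
- by case: (@nd_fresh x (a :: u)); rewrite e.
- exact: nd_inj.
Qed.

Lemma node_D x u : D (node x u) -> u = [::].
Proof. by case: u => //= a u /nd_fresh. Qed.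

Definition quarter (r : word) := size r %/ 4.
(** An arc is built from both ends: its first [owned p] orbits are named from
[exit p], the others from [entry p], where they are the first orbits of
[loop_bar p].  Both parts are longer than a piece, so that a point at the tip
of one of them determines the loop. *)
Definition owned p :=
  if pos (loop_word p) then arc_len p - quarter (loop_word p) else quarter (loop_word p).
(** The point at which the two parts meet would have two names; the negative
orientation gives up its own. *)
Definition renamed p j c :=
  [&& ~~ pos (loop_word p), j.+1 == quarter (loop_word p) & c == (nth l0 (loop_word p) j).2].
(** The points of the [j]-th orbit of the arc, parametrized by the group so
that [1] is where the arc enters the orbit and the [j]-th letter of the relator
is where it leaves.  Points other than [1] are named as if the arc left through
them, whence the folding of arcs with a common beginning. *)
Definition tree_point p j (c : Gam) : U :=
  if renamed p j c then node (entry p) (take (arc_len p - quarter (loop_word p)) (loop_word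
    (loop_bar p)))
  else if c == 1%g then node (exit p) (take j (loop_word p))
  else node (exit p) (rcons (take j (loop_word p)) ((nth l0 (loop_word p) j).1, c)).

Lemma loop_bounds p : is_loop p ->
  [/\ 64 <= size (loop_word p), arc_len p <= size (loop_word p),
    7 * size (loop_word p) <= 8 * arc_len p &
      [/\ 4 * quarter (loop_word p) <= size (loop_word p),
        size (loop_word p) < 4 * quarter (loop_word p) + 4 & 0 < arc_len p]].
Proof.
move=> h; have := arc_len_large h; have := arc_len_le h; have := sc_size SC (loop_word_R h).
by have := arc_len_gt h; rewrite /quarter; split; [| | |split]; lia.
Qed.

Lemma owned_lt p : is_loop p -> 0 < owned p < arc_len p.
Proof. by move=> /loop_bounds[] h1 h2 h3 [] h4 h5 h6; rewrite /owned; case: ifP => _; lia. Qed.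

Lemma quarter_bar p : quarter (loop_word (loop_bar p)) = quarter (loop_word p).
Proof. by rewrite /quarter size_loop_bar. Qed.

Lemma owned_bar p : is_loop p -> owned p + owned (loop_bar p) = arc_len p.
Proof.
move=> hp; have := loop_bounds hp; rewrite /owned quarter_bar pos_bar //.
by case=> h1 h2 h3 [] h4 h5 h6; case: (pos _) => /=; lia.
Qed.

Lemma sc_loop p q k : is_loop p -> is_loop q -> exit p = exit q ->
  size (loop_word p) <= 32 * k -> k <= size (loop_word p) ->
    take k (loop_word p) = take k (loop_word q) -> p = q.
Proof.
move=> hp hq ea h1 h2 e; apply: loop_uniq => //.
exact: (sc_piece SC (loop_word_R hp) (loop_word_R hq)) e.
Qed.

(** The [j]-th orbit depends on the loop only through the path leading to it:
a tip that is renamed lies beyond a piece, where the loops coincide. *)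
Lemma tree_point_key p q j c : is_loop p -> is_loop q -> exit p = exit q ->
  j < owned p -> j < owned q -> take j (loop_word p) = take j (loop_word q) ->
  (nth l0 (loop_word p) j).1 = (nth l0 (loop_word q) j).1 -> tree_point p j c = tree_point q j c.
Proof.
move=> hp hq ea jp jq et es.
have [p1 p2 p3 [p4 p5 p6]] := loop_bounds hp.
have [q1 q2 q3 [q4 q5 q6]] := loop_bounds hq.
case: (boolP (renamed p j c)) => [|np].
  case/and3P => _ /eqP hj _; suff -> : p = q by [].
  by apply: (sc_loop (k := j)) => //; lia.
case: (boolP (renamed q j c)) => [|nq].
  case/and3P => _ /eqP hj _; suff -> : p = q by [].
  by symmetry; apply: (sc_loop (k := j)) => //; lia.
by rewrite /tree_point (negbTE np) (negbTE nq) ea et es.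
Qed.

Lemma last_take (w : word) j : 0 < j <= size w -> last l0 (take j w) = nth l0 w j.-1.
Proof.
move=> h; rewrite -nth_last size_takel; last by lia.
by rewrite nth_take //; lia.
Qed.

Inductive tree_point_spec p j c : U -> Type :=
| TreePointVertex : c = 1%g -> tree_point_spec p j c (node (exit p) (take j (loop_word p)))
| TreePointInner : c <> 1%g ->
    tree_point_spec p j c (node (exit p) (rcons (take j (loop_word p)) ((nth l0 (loop_word p)
      j).1, c)))
| TreePointTip : pos (loop_word p) = false -> j.+1 = quarter (loop_word p) ->
  c = (nth l0 (loop_word p) j).2 ->
    tree_point_spec p j c (node (entry p) (take (arc_len p - quarter (loop_word p)) (loop_word
      (loop_bar p)))).

Lemma tree_pointP p j c : tree_point_spec p j c (tree_point p j c).
Proof.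
rewrite /tree_point; case: ifP => [/and3P[/negbTE h1 /eqP h2 /eqP h3]|_]; first exact: TreePointTip.
by case: eqP => h; [exact: TreePointVertex|exact: TreePointInner].
Qed.

Lemma side_pred p j : is_loop p -> j.+1 < size (loop_word p) ->
  (nth l0 (loop_word p) j.+1).1 = ~~ (nth l0 (loop_word p) j).1.
Proof. move=> hp; exact: (sc_alt SC (loop_word_R hp)). Qed.

(** Coming from the other end, one enters the meeting point by the letter of [p]
after it; its side tells the tip from the other points of the orbit. *)
Lemma tip_last p : is_loop p ->
  (last l0 (take (arc_len p - quarter (loop_word p)) (loop_word (loop_bar p)))).1
   = (nth l0 (loop_word p) (quarter (loop_word p))).1.
Proof.
move=> hp; have [h1 h2 h3 [h4 h5 h6]] := loop_bounds hp.
rewrite last_take ?size_loop_bar; last by lia.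
rewrite nth_loop_bar //; last by lia.
by rewrite /=; congr (nth _ _ _).1; lia.
Qed.

(** Two orbits of the same side that meet are one orbit, with the same
parametrization.  This is what makes the enlarged graph an action.  Names are
free, so only clashes between the three shapes of name are at stake: the name of
a base point ends with a letter of the other side, that of an inner point with
a letter of the side of the orbit, and a tip determines its loop. *)
Lemma tree_point_inj p q j i a b : is_loop p -> is_loop q -> j < owned p -> i < owned q ->
  (nth l0 (loop_word p) j).1 = (nth l0 (loop_word q) i).1 -> tree_point p j a = tree_point q i b ->
  [/\ exit p = exit q, j = i, take j (loop_word p) = take i (loop_word q) & a = b].
Proof.
move=> hp hq jp iq es.
have [p1 p2 p3 [p4 p5 p6]] := loop_bounds hp.
have [q1 q2 q3 [q4 q5 q6]] := loop_bounds hq.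
have Tp := owned_lt hp; have Tq := owned_lt hq.
have ap := exit_D hp; have aq := exit_D hq; have bp := entry_D hp; have bq := entry_D hq.
have size_eq r k (m : nat) (s : word) : k <= size r -> m <= size s -> take k r = take m s -> k = m.
  by move=> h1 h2 /(congr1 size); rewrite !size_takel.
have not_inner r k s c x : is_loop r -> k < owned r -> (nth l0 (loop_word r) k).1 = s ->
    take k (loop_word r) = rcons x (s, c) -> False.
  move=> hr kr e1 e2; have [h1 h2 h3 [h4 h5 h6]] := loop_bounds hr.
  have Tr := owned_lt hr; have k0 : 0 < k.
    by case: k e2 {kr e1} => //; rewrite take0; case: x.
  have := last_take (w := loop_word r) (j := k); rewrite e2 last_rcons => /(_ ltac:(lia)) e3.
  have := side_pred (j := k.-1) hr; rewrite prednK // => /(_ ltac:(lia)).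
  by rewrite -e3 e1 /=; case: s {e1 e2 e3}.
have not_tip r k r' k' : is_loop r -> is_loop r' -> k < owned r -> pos (loop_word r') = false ->
   k'.+1 = quarter (loop_word r') ->  node (exit r) (take k (loop_word r)) =
    node (entry r') (take (arc_len r' - quarter (loop_word r')) (loop_word (loop_bar r'))) -> False.
  move=> hr hr' kr pr' ek e; have [h1 h2 h3 [h4 h5 h6]] := loop_bounds hr'.
  have [g1 g2 g3 [g4 g5 g6]] := loop_bounds hr; have Tr := owned_lt hr.
  have [e1 e2] := node_inj (exit_D hr) (entry_D hr') e.
  have ek' : k = arc_len r' - quarter (loop_word r') by apply: size_eq e2;
    rewrite ?size_loop_bar; lia.
  have er : loop_bar r' = r.
    apply: (sc_loop (k := k)) => //; first exact: is_loop_bar.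
    - by rewrite size_loop_bar; lia.
    - by rewrite size_loop_bar; lia.
    - by rewrite {1}ek'.
  move: kr; rewrite -er /owned pos_bar // pr' quarter_bar /= ek'; lia.
have inner_not_tip r r' k' s c x : is_loop r' -> pos (loop_word r') = false ->
  k'.+1 = quarter (loop_word r') ->
   (nth l0 (loop_word r') k').1 = s -> D r ->
   node r (rcons x (s, c)) =
     node (entry r') (take (arc_len r' - quarter (loop_word r')) (loop_word (loop_bar r'))) ->
   False.
  move=> hr' pr' ek es' dr e; have [h1 h2 h3 [h4 h5 h6]] := loop_bounds hr'.
  have [e1 e2] := node_inj dr (entry_D hr') e.
  have := tip_last hr'; rewrite -e2 last_rcons /= -ek side_pred //; last by lia.
  by rewrite es'; case: s {es' e e2}.
case: (tree_pointP p j a) => [a1|a1|pp ej ea]; case: (tree_pointP q i b) => [b1|b1|qq ei eb] e.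
- have [e1 e2] := node_inj ap aq e; split=> //; last by rewrite a1 b1.
  by apply: size_eq e2; lia.
- have [e1 e2] := node_inj ap aq e; exfalso; exact: (not_inner p j) e2.
- exfalso; exact: (not_tip p j q i) e.
- have [e1 e2] := node_inj ap aq e; exfalso; apply: (not_inner q i) (esym e2) => //.
- have [e1 /rcons_inj[e2 _ e3]] := node_inj ap aq e; split=> //.
  by apply: size_eq e2; lia.
- by exfalso; exact: (inner_not_tip (exit p) q i _ _ _ hq qq ei (esym es) ap e).
- exfalso; exact: (not_tip q i p j) (esym e).
- by exfalso; exact: (inner_not_tip (exit q) p j _ _ _ hp pp ej es aq (esym e)).
- have [e1 e2] := node_inj bp bq e.
  have ep : loop_bar p = loop_bar q.
    have eM : arc_len p - quarter (loop_word p) = arc_len q - quarter (loop_word q).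
      by apply: size_eq e2; rewrite size_loop_bar; lia.
    apply: (sc_loop (k := arc_len p - quarter (loop_word p))); rewrite ?size_loop_bar //;
      try exact: is_loop_bar; try lia.
    by rewrite {2}eM.
  have {}ep : p = q by rewrite -[p]loop_barK ?ep ?loop_barK //; lia.
  subst q; have eji : j = i by lia.
  by subst i; rewrite ea eb.
Qed.

Lemma tree_point_D p j c : is_loop p -> j < owned p -> D (tree_point p j c) -> [/\ c = 1%g,
  j = 0 & tree_point p j c = exit p].
Proof.
move=> hp jp; have [h1 h2 h3 [h4 h5 h6]] := loop_bounds hp; have Tp := owned_lt hp.
case: tree_pointP => [c1|c1|pp ej ec] /node_D.
- by case: j jp => [|j] jp; [rewrite take0 | move/(congr1 size); rewrite size_takel //; lia].
- by case: (take _ _).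
- by move/(congr1 size); rewrite size_takel ?size_loop_bar //=; lia.
Qed.

(** [st] with the orbits of all arcs added; at a tree point, side [l.1] acts by
right translation of the parameter. *)
Definition close_step (x : U) (l : letter Gam) (y : U) : Prop :=
  st x l y \/ exists p j a, [/\ is_loop p, j < owned p, l.1 = (nth l0 (loop_word p) j).1,
    x = tree_point p j a & y = tree_point p j (a * l.2)%g].

(** The new orbits do not overlap the old ones: the only old point of an arc
counted here is its exit, where [st] is undefined on that side. *)
Lemma tree_st p j a y s b : is_loop p -> j < owned p -> s = (nth l0 (loop_word p) j).1 ->
  ~ st (tree_point p j a) (s, b) y.
Proof.
move=> hp jp -> h; have [_ j0 e] := tree_point_D hp jp (Dst h).
move: h; rewrite e j0 => h; apply: (st_undef (b := (nth l0 (loop_word p) 0).2) h) => z.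
by rewrite -surjective_pairing; exact: exit_undef.
Qed.

Lemma tree_point_move p q j i a b c : is_loop p -> is_loop q -> j < owned p -> i < owned q ->
  (nth l0 (loop_word p) j).1 = (nth l0 (loop_word q) i).1 -> tree_point p j a = tree_point q i b ->
  tree_point p j (a * c) = tree_point q i (b * c).
Proof.
move=> hp hq jp iq es e; have [e1 e2 e3 ->] := tree_point_inj hp hq jp iq es e.
by subst i; apply: tree_point_key.
Qed.

Lemma close_action : action close_step.
Proof.
split.
- move=> x [s a] y y' [h|[p [j [b [hp jp es ex ey]]]]] [h'|[q [i [c [hq iq es' ex' ey']]]]].
  + exact: (act_det Ast h h').
  + by case: (@tree_st q i c y s a) => //; rewrite -ex'.
  + by case: (@tree_st p j b y' s a) => //; rewrite -ex.
  + by rewrite ey ey'; apply: tree_point_move => //; [rewrite -es -es'|rewrite -ex -ex'].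
- move=> x s a y b z [h|[p [j [c [hp jp es ex ey]]]]] [h'|[q [i [d [hq iq es' ex' ey']]]]].
  + by left; exact: (act_mul Ast h h').
  + by case: (@tree_st q i d x s a^-1%g) => //; rewrite -ex'; exact: act_inv.
  + by case: (@tree_st p j (c * a)%g z s b) => //; rewrite -ey.
  + right; exists p, j, c; split=> //; rewrite ey' mulgA; symmetry.
    by apply: tree_point_move => //; [rewrite -es -es'|rewrite -ey -ex'].
- move=> x s a y b [h|[p [j [c [hp jp es ex ey]]]]].
    by have [z hz] := act_tot Ast b h; exists z; left.
  by exists (tree_point p j (c * b)%g); right; exists p, j, c.
- move=> x s y [h|[p [j [c [hp jp es ex ey]]]]]; first exact: act_one h.
  by rewrite ey ex mulg1.
- move=> x s a y [h|[p [j [c [hp jp es ex ey]]]]]; first by left; exact: act_inv.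
  by right; exists p, j, (c * a)%g; split; rewrite // mulgK.
- move=> x s a [h|[p [j [c [hp jp es ex ey]]]]]; first exact: act_free h.
  have [_ _ _ e] := tree_point_inj hp hp jp jp erefl (etrans (esym ex) ey).
  by apply: (mulgI c); rewrite mulg1.
Qed.

(** The orbits of the whole arc, indexed from [exit p].  The orbits owned by the
other end are parametrized there from the opposite base point, hence the
translation by the inverse of the [j]-th letter. *)
Definition arc_point p j c : U := if j < owned p then tree_point p j c
  else tree_point (loop_bar p) (arc_len p - j.+1) ((nth l0 (loop_word p) j).2^-1 * c)%g.

Lemma nth_bar p j : is_loop p -> j < arc_len p ->
  nth l0 (loop_word (loop_bar p)) (arc_len p - j.+1) = linv (nth l0 (loop_word p) j).
Proof.
move=> hp jp; rewrite nth_loop_bar; [|exact: arc_len_le|lia].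
by congr linv; congr nth; lia.
Qed.

Lemma arc_point_bar p j c : is_loop p -> j < arc_len p ->
  arc_point (loop_bar p) (arc_len p - j.+1) ((nth l0 (loop_word p) j).2^-1 * c)%g = arc_point p j c.
Proof.
move=> hp jp; have Tb := owned_bar hp; rewrite {2}/arc_point.
case: ifP => h; rewrite /arc_point.
  rewrite ifF; last by lia.
  rewrite loop_barK; last exact: arc_len_le.
  rewrite nth_bar // /= invgK mulVKg; congr tree_point; lia.
by rewrite ifT //; lia.
Qed.

Lemma arc_point_step p j a b : is_loop p -> j < arc_len p ->
  close_step (arc_point p j a) ((nth l0 (loop_word p) j).1, b) (arc_point p j (a * b)%g).
Proof.
move=> hp jp; have Tb := owned_bar hp; right; rewrite /arc_point; case: ifP => h.
  by exists p, j, a.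
exists (loop_bar p), (arc_len p - j.+1), ((nth l0 (loop_word p) j).2^-1 * a)%g; split=> //.
- exact: is_loop_bar.
- by lia.
- by rewrite nth_bar.
- by rewrite mulgA.
Qed.

Lemma letter_neq1 q i : is_loop q -> i < arc_len q -> ((nth l0 (loop_word q) i).2 == 1%g) = false.
Proof.
  move=> hq ip; apply/eqP; apply: (sc_neq1 SC (loop_word_R hq)).
  by exact: leq_trans ip (arc_len_le hq).
Qed.

(** Consecutive orbits of the arc share the vertex between them.  Inside one
part this is the choice of names; at the junction of the two parts it is the
renaming. *)
Lemma arc_point_glue_tree p i : is_loop p -> i.+1 < arc_len p -> i < owned p ->
  arc_point p i (nth l0 (loop_word p) i).2 = arc_point p i.+1 1%g.
Proof.
  move=> hp ip ito; have [h1 h2 h3 [h4 h5 h6]] := loop_bounds hp.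
  have Tb := owned_bar hp; rewrite /arc_point ito.
  have lp : rcons (take i (loop_word p)) ((nth l0 (loop_word p) i).1,
    (nth l0 (loop_word p) i).2) = take i.+1 (loop_word p).
    by rewrite -surjective_pairing -take_nth //; lia.
  case: ifP => h.
    rewrite /tree_point /renamed letter_neq1 //; last by lia.
    have -> : (i.+1 == quarter (loop_word p)) && ((nth l0 (loop_word p) i).2 ==
      (nth l0 (loop_word p) i).2) =
       (i.+1 == quarter (loop_word p)) by rewrite eqxx andbT.
    rewrite eqxx ![1%g == _]eq_sym letter_neq1 // !andbF lp.
    by case: ifP => // /andP[/negbTE e /eqP e2]; move: h; rewrite /owned e -e2; lia.
  have e1 : i.+1 = owned p by lia.
  rewrite mulg1 -[(nth l0 (loop_word p) i.+1).2^-1%g]/((linv (nth l0 (loop_word p) i.+1)).2)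
    -nth_bar //.
  have e2 : (arc_len p - i.+2).+1 = owned (loop_bar p) by lia.
  have hb := is_loop_bar hp.
  have n1 := letter_neq1 hp (ltnW ip).
  have n2 : ((nth l0 (loop_word (loop_bar p)) (arc_len p - i.+2)).2 == 1%g) = false.
    by apply: letter_neq1 => //; change (arc_len p - i.+2 < arc_len p); lia.
  rewrite /tree_point /renamed !eqxx !andbT n1 n2 pos_bar // negbK quarter_bar.
  move: e1 e2; rewrite /owned pos_bar // quarter_bar; case: (pos (loop_word p));
    cbv beta iota delta [negb] => e1 e2.
    rewrite e2 eqxx -surjective_pairing -take_nth; last by lia.
    by rewrite e1 loop_barK.
  rewrite e1 eqxx; congr node; rewrite -surjective_pairing -take_nth ?size_loop_bar; last by lia.
  by congr take; lia.
Qed.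

Lemma arc_point_glue p j : is_loop p -> j.+1 < arc_len p ->
  arc_point p j (nth l0 (loop_word p) j).2 = arc_point p j.+1 1%g.
Proof.
move=> hp jp; have Tb := owned_bar hp; case: (ltnP j (owned p)) => h;
  first exact: arc_point_glue_tree.
have := arc_point_glue_tree (p := loop_bar p) (i := arc_len p - j.+2) (is_loop_bar hp).
change (arc_len (loop_bar p)) with (arc_len p) => /(_ ltac:(lia) ltac:(lia)).
rewrite -(arc_point_bar _ hp jp) => e; rewrite -(arc_point_bar _ hp (ltnW jp)) mulVg.
rewrite mulg1 -[(nth l0 (loop_word p) j.+1).2^-1%g]/((linv (nth l0 (loop_word p) j.+1)).2)
  -nth_bar // e.
by congr arc_point; lia.
Qed.

(** The vertices of the arc, from [exit p] at [0] to [entry p] at [arc_len p]. *)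
Definition arc_vertex p i : U := if i < arc_len p then arc_point p i 1%g else entry p.

Lemma arc_vertex_0 p : is_loop p -> arc_vertex p 0 = exit p.
Proof.
move=> hp; have Tp := owned_lt hp; rewrite /arc_vertex arc_len_gt // /arc_point ifT; last by lia.
case: tree_pointP; first by rewrite take0.
  by [].
by move=> _ _ e; case: (sc_neq1 SC (loop_word_R hp) (i := 0)); [have := arc_len_le hp; lia|].
Qed.

Lemma arc_point_vertex p i : is_loop p -> i < arc_len p ->
  arc_point p i (nth l0 (loop_word p) i).2 = arc_vertex p i.+1.
Proof.
move=> hp ip; rewrite /arc_vertex; case: ltnP => h; first exact: arc_point_glue.
have ei : arc_len p - i.+1 = 0 by lia.
rewrite -(arc_point_bar _ hp ip) mulVg ei -[RHS](arc_vertex_0 (is_loop_bar hp)) /arc_vertex ifT //.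
by exact: arc_len_gt hp.
Qed.

Lemma arc_vertex_step p i : is_loop p -> i < arc_len p ->
  close_step (arc_vertex p i) (nth l0 (loop_word p) i) (arc_vertex p i.+1).
Proof.
move=> hp ip; rewrite -arc_point_vertex // /arc_vertex ip.
by have := arc_point_step 1%g (nth l0 (loop_word p) i).2 hp ip; rewrite mul1g -surjective_pairing.
Qed.

Lemma arc_vertex_bar p i : is_loop p -> i <= arc_len p ->
  arc_vertex (loop_bar p) (arc_len p - i) = arc_vertex p i.
Proof.
move=> hp; case: i => [|i] ip.
  by rewrite subn0 arc_vertex_0 // /arc_vertex ltnn.
rewrite -arc_point_vertex // -(arc_point_bar _ hp ip) mulVg /arc_vertex ifT //.
change (arc_len p - i.+1 < arc_len p); lia.
Qed.

Lemma arc_run p i k : is_loop p -> i + k <= arc_len p ->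
  run close_step (arc_vertex p i) (take k (drop i (loop_word p))) (arc_vertex p (i + k)).
Proof.
move=> hp; have := arc_len_le hp; elim: k i => [|k IH] i h1 h; first by rewrite take0 addn0.
rewrite (drop_nth l0) //=; last by lia.
exists (arc_vertex p i.+1); first by apply: arc_vertex_step => //; lia.
by rewrite addnS -addSn; apply: IH => //; lia.
Qed.

Lemma loop_closed p i : is_loop p -> i <= arc_len p ->
  run close_step (arc_vertex p i) (rot i (loop_word p)) (arc_vertex p i).
Proof.
move=> hp ip.
have h0 : run close_step (exit p) (loop_word p) (exit p).
  rewrite -[X in run _ _ X](cat_take_drop (arc_len p)); apply/run_cat; exists (entry p).
    have := arc_run (i := 0) (k := arc_len p) hp (leqnn _).
    by rewrite drop0 arc_vertex_0 // add0n /arc_vertex ltnn.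
  by apply: run_mono (tail_run hp); left.
apply: closed_rot h0; first exact: close_action.
by have := arc_run (i := 0) (k := i) hp ip; rewrite drop0 arc_vertex_0.
Qed.

(** A relator not closed in [st] stops somewhere when read from [x], and stops
again when read backwards from there; the two stopping points are the ends of
a loop, whose arc closes the relator. *)
Lemma closed_D x r : D x -> R r -> run close_step x r x.
Proof.
move=> dx hr.
case: (pselect (run st x r x)) => [h|nh]; first by apply: run_mono h; left.
have [k kr [[a ha] hk]] : exists2 k, k < size r & (exists y, run st x (take k r) y) /\
    ~ (exists y, run st x (take k.+1 r) y).
  apply: (last_before (P := fun k => exists y, run st x (take k r) y)).
    by exists x; rewrite take0.
  move=> [y]; rewrite take_size => h; apply: nh; apply: (Inv (k := size r) hr) (_ : run st x _ y) _.
    by rewrite take_size.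
  lia.
pose r1 := rot k r; have hr1 : R r1 by exact: (sc_rot SC).
have s1 : size r1 = size r by rewrite size_rot.
have Da : D a.
  case: k {kr hk r1 hr1 s1} ha => [|k]; first by rewrite take0 => <-.
  move=> /(run_winv Ast); case: (winv (take k.+1 r)) => [->|l w] //= [z /Dst] //.
have un z : ~ st a (nth l0 r1 0) z.
  move=> hz; apply: hk; exists z; rewrite (take_nth l0) // -cats1; apply/run_cat; exists a => //.
  by exists z => //; move: hz; rewrite /r1 /rot nth_cat size_drop subn_gt0 kr nth_drop addn0.
have nh1 : ~ run st a (winv r1) a.
  move=> /(closed_winv a r1 Ast).2 h; apply: nh; exact: (closed_unrot Ast ha h).
have [m mr [[b hb] hm]] : exists2 m, m < size r1 & (exists y, run st a (take m (winv r1)) y) /\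
    ~ (exists y, run st a (take m.+1 (winv r1)) y).
  apply: (last_before (P := fun k => exists y, run st a (take k (winv r1)) y)).
    by exists a; rewrite take0.
  move=> [y h]; apply: nh1; apply: (Inv (k := size r1)) h _; first exact: (sc_inv SC).
  by rewrite size_winv; lia.
have Db : D b.
  case: m {mr hm} hb => [|m]; first by rewrite take0 => <-.
  move=> /(run_winv Ast); case: (winv (take m.+1 _)) => [->|l w] //= [z /Dst] //.
have etail : winv (take m (winv r1)) = drop (size r1 - m) r1.
  rewrite -{1}(cat_take_drop (size r1 - m) r1) winv_cat take_size_cat ?winvK //.
  by rewrite size_winv size_drop; lia.
pose p := Loop a r1 b (size r1 - m).
have hp : is_loop p.
  split=> //=; try lia.
  - by rewrite -etail; exact: run_winv.
  - move=> z hz; apply: hm; exists z; rewrite (take_nth l0) ?size_winv // -cats1; apply/run_cat.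
    exists b => //; exists z => //; rewrite nth_winv //.
    by move: hz; congr (st _ (linv (nth _ _ _)) _); lia.
apply: (closed_unrot close_action (k := k) (y := a)); first by apply: run_mono ha; left.
have := loop_closed (i := 0) hp (leq0n _); by rewrite rot0 arc_vertex_0.
Qed.

(** [tree_pointP] in a form that keeps the point itself in the goal. *)
Lemma tree_point_cases p j c :
  [\/ c = 1%g /\ tree_point p j c = node (exit p) (take j (loop_word p)),
      c <> 1%g /\ tree_point p j c =
        node (exit p) (rcons (take j (loop_word p)) ((nth l0 (loop_word p) j).1, c))
    | [/\ pos (loop_word p) = false, j.+1 = quarter (loop_word p), c = (nth l0 (loop_word p) j).2 &
       tree_point p j c = node (entry p) (take (arc_len p - quarter (loop_word p)) (loop_word
         (loop_bar p)))]].
Proof. by case: tree_pointP => *; [constructor 1|constructor 2|constructor 3]. Qed.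

Lemma vertex_tree_point p j : is_loop p -> j < owned p -> arc_vertex p j = tree_point p j 1%g.
Proof. by move=> hp jp; have /andP[_ h] := owned_lt hp;
  rewrite /arc_vertex /arc_point jp ifT //; exact: ltn_trans jp h. Qed.

Lemma tree_point_vertex p j : is_loop p -> j < owned p ->
  tree_point p j (nth l0 (loop_word p) j).2 = arc_vertex p j.+1.
Proof. by move=> hp jp; have /andP[_ h] := owned_lt hp;
  rewrite -arc_point_vertex /arc_point ?jp //; exact: ltn_trans jp h. Qed.

(** Where the orbits of two arcs, of opposite sides, meet away from the base
point, some arc with the same exit goes through that point: the meeting point
is named after such an arc. *)
Lemma fork p q j i c a : is_loop p -> is_loop q -> j < owned p -> i < owned q ->
  (nth l0 (loop_word q) i).1 = ~~ (nth l0 (loop_word p) j).1 ->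
    tree_point p j c = tree_point q i a ->
  c = 1%g \/ exists p1, [/\ is_loop p1, exit p1 = exit p, j < owned p1,
    take j.+1 (loop_word p1) = rcons (take j (loop_word p)) ((nth l0 (loop_word p) j).1, c) &
    tree_point p j c = arc_vertex p1 j.+1].
Proof.
move=> hp hq jp iq es e.
have [p1 p2 p3 [p4 p5 p6]] := loop_bounds hp.
have [q1 q2 q3 [q4 q5 q6]] := loop_bounds hq.
have Tp := owned_lt hp; have Tq := owned_lt hq.
have ap := exit_D hp; have aq := exit_D hq; have bp := entry_D hp; have bq := entry_D hq.
case: (tree_point_cases p j c) => [[c1 _]|[c1 ep]|[pp ej c1 ep]]; first by left.
  right; case: (tree_point_cases q i a) => [[a1 eq]|[a1 eq]|[qq ei a1 eq]].
  - move: e; rewrite ep eq => /(node_inj ap aq)[e1 e2].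
    have ei : i = j.+1.
      by move/(congr1 size): e2; rewrite size_rcons !size_takel //; lia.
    subst i; exists q; split=> //; first by lia.
      by rewrite vertex_tree_point // -[in RHS]a1 eq e1 e2.
  - move: e; rewrite ep eq => /(node_inj ap aq)[_ /rcons_inj[_ e3 _]].
    by move: es; rewrite e3; case: (_.1).
  - move: e; rewrite ep eq => /(node_inj ap bq)[e1 e2].
    have ej : j.+1 = arc_len q - quarter (loop_word q).
      by move/(congr1 size): e2; rewrite size_rcons !size_takel ?size_loop_bar //; lia.
    have Tb := owned_bar hq.
    have jb : j.+1 = owned (loop_bar q) by rewrite ej /owned pos_bar // qq quarter_bar.
    exists (loop_bar q); split=> //; first exact: is_loop_bar.
    + by lia.
    + by rewrite ej e2.
    + rewrite ej arc_vertex_bar //; last by lia.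
      by rewrite -ei -tree_point_vertex // -a1 eq e1 e2.
right; exists p; split=> //; last by rewrite c1 tree_point_vertex.
by rewrite c1 -surjective_pairing -take_nth //; lia.
Qed.

(** Leaving the [j]-th orbit of an arc at a point that is not its base point,
by the other side.  Either one goes on along an arc with the same beginning
(first case), or one has left for an arc coming from the other end, and this
arc agrees with the reverse of the former one as far as the orbit, where the two
part (second case); the former arc then ends within a piece from there. *)
Lemma turn p j c l y : is_loop p -> j < arc_len p -> c <> 1%g -> ~ D (arc_point p j c) ->
  close_step (arc_point p j c) l y -> l.1 = ~~ (nth l0 (loop_word p) j).1 ->
  (exists p1, [/\ is_loop p1, j.+1 < arc_len p1,
     take j.+1 (loop_word p1) = rcons (take j (loop_word p)) ((nth l0 (loop_word p) j).1, c) &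
     arc_point p j c = arc_vertex p1 j.+1]) \/
  (exists p1, [/\ is_loop p1, (arc_len p - j.+1).+1 < arc_len p1,
     take (arc_len p - j.+1) (loop_word p1) = take (arc_len p - j.+1) (loop_word (loop_bar p)),
     nth l0 (loop_word p1) (arc_len p - j.+1) <> nth l0 (loop_word (loop_bar p)) (arc_len p -
       j.+1) &
     (nth l0 (loop_word p1) (arc_len p - j.+1)).1 = (nth l0 (loop_word p) j).1 /\
     arc_point p j c = arc_vertex p1 (arc_len p - j.+1).+1]).
Proof.
move=> hp jp c1 nD [/Dst //|[q [i [a [hq iq es e _]]]]] el.
have Tb := owned_bar hp; have hb := is_loop_bar hp.
case: (ltnP j (owned p)) => jt.
  left; move: e; rewrite /arc_point jt => e.
  case: (fork hp hq jt iq _ e) => [|//|[p1 [h1 h2 h3 h4 h5]]]; first by rewrite -es.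
  by exists p1; split=> //; have := owned_lt h1; lia.
have et : arc_point p j c =
  tree_point (loop_bar p) (arc_len p - j.+1) ((nth l0 (loop_word p) j).2^-1 * c)%g.
  by rewrite /arc_point ltnNge jt.
move: e; rewrite {1}et => e.
have nb := nth_bar hp jp.
case: (fork hb hq _ iq _ e) => [||c2|[p1 [h1 h2 h3 h4 h5]]].
- lia.
- by rewrite -es el nb.
- have ec : c = (nth l0 (loop_word p) j).2.
    by apply: (mulgI (nth l0 (loop_word p) j).2^-1%g); rewrite c2 mulVg.
  have js : j < size (loop_word p) := leq_trans jp (arc_len_le hp).
  left; exists p; rewrite ec -surjective_pairing -take_nth // arc_point_vertex //.
  split=> //; rewrite ltn_neqAle jp andbT; apply/eqP => e3; apply: nD.
  by rewrite ec arc_point_vertex // e3 /arc_vertex ltnn; exact: entry_D.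
right; exists p1.
have [T1 T2] := andP (owned_lt h1); have L1 := arc_len_le h1.
have hs : arc_len p - j.+1 < size (loop_word p1) by lia.
move: h4; rewrite (take_nth l0) // => /rcons_inj[h4 h6]; split=> //.
- lia.
- move=> /(congr1 snd); rewrite h6 nb /= => e2.
  by apply: c1; apply: (mulgI (nth l0 (loop_word p) j).2^-1%g); rewrite e2 mulg1.
- by rewrite h6 nb et.
Qed.

(** A new point at which both sides are defined is a vertex of an arc, and this
arc can be travelled in the wanted direction. *)
Lemma on_loop z l l' y y' : ~ D z -> close_step z l y -> close_step z l' y' -> l.1 = ~~ l'.1 ->
  exists p j, [/\ is_loop p, 0 < j < arc_len p,
    z = arc_vertex p j & (nth l0 (loop_word p) j).1 = l.1].
Proof.
move=> nD [/Dst //|[q [i [a [hq iq es e _]]]]] [/Dst //|[p [j [c [hp jp es' e' _]]]]] el.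
have [p1 p2 p3 [p4 p5 p6]] := loop_bounds hp; have Tp := owned_lt hp.
have := fork hp hq jp iq _ (etrans (esym e') e).
rewrite -es -es' => /(_ el)[c1|[p' [h1 h2 h3 h4 h5]]].
  have ez : z = arc_vertex p j by rewrite e' c1 vertex_tree_point.
  have j0 : 0 < j.
    by case: j ez {jp e' es'} => // ez; case: nD; rewrite ez arc_vertex_0 //; exact: exit_D.
  exists (loop_bar p), (arc_len p - j); split.
  - exact: is_loop_bar.
  - by change (arc_len (loop_bar p)) with (arc_len p); lia.
  - by rewrite arc_vertex_bar //; lia.
  - have -> : arc_len p - j = arc_len p - j.-1.+1 by rewrite prednK.
    rewrite nth_bar //=; last by lia.
    rewrite el es'; have := side_pred (j := j.-1) hp; rewrite prednK // => -> //; last by lia.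
    by rewrite negbK.
exists p', j.+1; have [T1 T2] := andP (owned_lt h1); have L1 := arc_len_le h1; split=> //.
- lia.
- by rewrite -h5.
- rewrite side_pred //; last by lia.
  have := congr1 (last l0) h4; rewrite last_rcons last_take //=; last by lia.
  by move=> ->; rewrite el.
Qed.

Definition alternating (u : word) : Prop :=
  (forall i, i < size u -> (nth l0 u i).2 <> 1%g) /\
  (forall i, i.+1 < size u -> (nth l0 u i.+1).1 = ~~ (nth l0 u i).1).


Definition avoids x (u : word) : Prop :=
  forall i y, i <= size u -> run close_step x (take i u) y -> ~ D y.

(** Starting from [x], the [j]-th vertex of [p], the first [t] letters of [u]
follow an arc [p1] that begins as [p] does up to that vertex. *)
Definition rides x u p j p1 t : Prop :=
  [/\ is_loop p1, take j (loop_word p1) = take j (loop_word p), j + t < arc_len p1,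
     take t u = take t (drop j (loop_word p1)) & run close_step x (take t u) (arc_vertex p1 (j +
       t))].

(** After [t] letters along [p1], the letter number [t] of [u] leads to the
vertex [i.+1] of an arc [p2]; this arc begins as the reverse of [p1] does, up to
the orbit that [u] has just crossed, where they part. *)
Definition turns x u p1 j t p2 i : Prop :=
  [/\ is_loop p2, i.+1 + (j + t) = arc_len p1, i.+1 < arc_len p2,
      take i (loop_word p2) = take i (loop_word (loop_bar p1)) &
      [/\ nth l0 (loop_word p2) i <> nth l0 (loop_word (loop_bar p1)) i, t.+1 < size u,
      run close_step x (take t.+1 u) (arc_vertex p2 i.+1) &
      (nth l0 (loop_word p2) i.+1).1 = (nth l0 u t.+1).1]].

(** A path among the new points follows an arc until it turns, or to its end
except perhaps for the last letter; changes of arc of the first kind in [turn] are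
absorbed by changing [p1]. *)
Lemma ride u p j z : is_loop p -> 0 < j < arc_len p -> alternating u ->
  run close_step (arc_vertex p j) u z -> avoids (arc_vertex p j) u ->
    (nth l0 (loop_word p) j).1 = (nth l0 u 0).1 ->
  exists p1 t, [/\ t <= size u, rides (arc_vertex p j) u p j p1 t &
    size u <= t.+1 \/ exists p2 i, turns (arc_vertex p j) u p1 j t p2 i].
Proof.
move=> hp hj [au1 au2] hr av s0.
have A' := close_action.
suff H n : forall p1 t, size u - t <= n -> t <= size u -> rides (arc_vertex p j) u p j p1 t ->
    (nth l0 (loop_word p1) (j + t)).1 = (nth l0 u t).1 ->
    exists p1 t, [/\ t <= size u, rides (arc_vertex p j) u p j p1 t &
    size u <= t.+1 \/ exists p2 i, turns (arc_vertex p j) u p1 j t p2 i].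
  apply: (H (size u) p 0) => //; rewrite ?subn0 ?addn0 //; split; rewrite ?addn0 ?take0 //.
  by case/andP: hj.
elim: n => [|n IH] p1 t hn tu rd es.
  by exists p1, t; split=> //; left; lia.
case: (leqP (size u) t.+1) => tu1; first by exists p1, t; split=> //; left.
have [h1 h2 h3 h4 h5] := rd.
have [y h6 h7] : exists2 y,
  close_step (arc_vertex p1 (j + t)) (nth l0 u t) y & run close_step y (drop t.+1 u) z.
  move: hr; rewrite -{1}(cat_take_drop t u) => /run_cat[x /(run_det A' h5) <-].
  by rewrite (drop_nth l0) //; exact: ltnW.
have [y2 h8 _] : exists2 y2, close_step y (nth l0 u t.+1) y2 & True.
  by move: h7; rewrite (drop_nth l0) // => -[y2 h8 _]; exists y2.
have h9 : run close_step (arc_vertex p j) (take t.+1 u) y.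
  rewrite (take_nth l0) // ?(ltnW tu1) // -cats1; apply/run_cat;
    exists (arc_vertex p1 (j + t)) => //.
  by exists y.
have ey : y = arc_point p1 (j + t) (nth l0 u t).2.
  apply: (act_det A' h6); have := arc_point_step 1%g (nth l0 u t).2 h1 h3.
  by rewrite mul1g es -surjective_pairing /arc_vertex h3.
have ny : ~ D y := av t.+1 y (ltnW tu1) h9.
have L1 := arc_len_le h1.
rewrite ey in h8 ny.
case: (turn h1 h3 (au1 _ (ltnW tu1)) ny h8); first by rewrite es au2.
  case=> p2 [g1 g2 g3 g4]; apply: (IH p2 t.+1 _ (ltnW tu1)); first by lia.
    have L2 := arc_len_le g1.
    move: g3; rewrite es -surjective_pairing => g3.
    move: g3; rewrite (take_nth l0); last by lia.
    case/rcons_inj => g5 g6.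
    split=> //.
    - by rewrite -(take_takel _ (leq_addr t j)) g5 take_takel ?leq_addr.
    - by rewrite addnS.
    - rewrite (take_nth l0) ?(ltnW tu1) // (take_nth l0) ?size_drop; last by lia.
      rewrite nth_drop g6 h4; congr rcons.
      by rewrite !take_drop addnC g5.
    - by rewrite addnS -g4 -ey.
  rewrite addnS side_pred //; last by have := arc_len_le g1; lia.
  rewrite au2 //; congr negb.
  have := congr1 (last l0) g3; rewrite last_rcons last_take //=; last by have := arc_len_le g1; lia.
  by move=> ->.
case=> p2 [g1 g2 g3 g4 [g5 g6]]; exists p1, t; split=> //; right.
exists p2, (arc_len p1 - (j + t).+1); split=> //; first by lia.
split=> //; first by rewrite -g6 -ey.
rewrite side_pred //; last by have := arc_len_le g1; lia.
by rewrite g5 es au2.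
Qed.

Lemma alternating_drop r k n : R r -> alternating (drop n (take k r)).
Proof.
move=> hr; split=> i; rewrite size_drop size_take_min => h.
  by rewrite nth_drop nth_take; [apply: (sc_neq1 SC)|]; rewrite //; lia.
rewrite !nth_drop !nth_take; try lia.
by rewrite addnS (sc_alt SC) //; lia.
Qed.

(** Suppose that the path is not closed.  It then avoids [D], where all
relators are closed by [closed_D].  Its first letter brings it to a vertex of an
arc; it follows that arc for less than a piece, since otherwise its label would
be that of the loop.  It may then turn, at less than a piece from the end of the
arc, and follow another arc for less than a piece.  A second turn would again be
less than a piece from the end of that arc, which would then have about 3/32 of
the length of its relator, against [arc_len_large].  Thus the path has at most two
pieces and three letters, less than 1/8 of the relator. *)
Lemma close_invariant x y r k : R r -> run close_step x (take k r) y -> size r <= 8 * k ->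
  run close_step x r x.
Proof.
move=> hr; wlog kr : k / k <= size r => [H|].
  case: (leqP k (size r)) => h; first exact: H.
  rewrite take_oversize ?(ltnW h) // => h1 h2.
  by apply: (H (size r)); rewrite ?take_size //; lia.
move=> hrun hk; apply: contrapT => nc.
have A' := close_action; have r64 := sc_size SC hr.
set w := take k r in hrun.
have sw : size w = k by rewrite size_takel.
have tw i : i <= k -> take i w = take i r by move=> ik; rewrite take_takel.
have nD i z : i <= k -> run close_step x (take i w) z -> ~ D z.
  move=> ik; rewrite tw // => hi dz; apply: nc; apply: (closed_unrot A' hi).
  by apply: closed_D => //; exact: (sc_rot SC).
(* The path cannot follow an arc for as much as a piece. *)
have short i t p a : is_loop p -> i + t <= k -> a + t <= arc_len p ->
    run close_step x (take (i + t) w) (arc_vertex p (a + t)) ->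
    take t (drop i w) = take t (drop a (loop_word p)) ->
    32 * t < size r /\ 32 * t < size (loop_word p).
  move=> hp itk atp hrn et; have L := arc_len_le hp.
  have et2 : take t (rot i r) = take t (rot a (loop_word p)).
    rewrite /rot !takel_cat ?size_drop; try lia.
    by rewrite -et /w !take_drop take_takel //; lia.
  apply: contrapT => hn; apply: nc.
  rewrite tw // in hrn; apply: (closed_unrot A' hrn).
  have er : rot i r = rot a (loop_word p).
    have R1 := sc_rot SC i hr; have R2 := sc_rot SC a (loop_word_R hp).
    case: (leqP (size r) (32 * t)) => h1.
      by apply: (sc_piece SC R1 R2 _ _ et2); rewrite size_rot; lia.
    symmetry; apply: (sc_piece SC R2 R1 _ _ (esym et2)); rewrite size_rot; first by lia.
    by rewrite leqNgt; apply/negP => h2; apply: hn.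
  suff -> : rot (i + t) r = rot (a + t) (loop_word p) by exact: loop_closed.
  by rewrite (addnC i) (addnC a) !rotD ?er //; lia.
have sdw n : size (drop n w) = k - n by rewrite size_drop sw.
have takeS n i : i <= size (drop n w) -> take (n + i) w = take n w ++ take i (drop n w).
  by move=> _; rewrite takeD.
have avd n z : n <= k -> run close_step x (take n w) z -> avoids z (drop n w).
  move=> nk hz i y' hi hy; rewrite sdw in hi; apply: (nD (n + i)); first by lia.
  by rewrite takeD; apply/run_cat; exists z.
have rund n z : run close_step x (take n w) z -> run close_step z (drop n w) y.
  move=> hz; move: hrun; rewrite -{1}(cat_take_drop n w).
  by case/run_cat => z' /(run_det A' hz) <-.
(* The first letter may cross an orbit between two points that are not on its
   arc; after it, the point has both sides defined. *)
have [z1 hz1] := run_take 1 hrun.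
have k1 : 1 < k by lia.
have [p [j [hp hj ez sj]]] : exists p j, [/\ is_loop p, 0 < j < arc_len p, z1 = arc_vertex p j &
     (nth l0 (loop_word p) j).1 = (nth l0 w 1).1].
  have := rund _ _ hz1; rewrite (drop_nth l0) ?sw // => -[y1 hy1 _].
  have : close_step x (nth l0 w 0) z1.
    by move: hz1; rewrite (take_nth l0) ?sw ?take0 //=; [case=> ? h <- | lia].
  case e : (nth l0 w 0) => [s a] /(act_inv A') h.
  apply: (on_loop (nD 1 z1 (ltnW k1) hz1) hy1 h) => /=.
  have [_ h2] := alternating_drop k 0 hr; rewrite drop0 -/w in h2.
  by rewrite h2 ?sw // e.
rewrite ez in hz1.
have [p1 [t1 [ht1 rd1 tn1]]] :=
  ride hp hj (alternating_drop k 1 hr) (rund _ _ hz1) (avd _ _ (ltnW k1) hz1)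
   (etrans sj (esym (congr1 fst (nth_drop 1 l0 w 0)))).
rewrite -/w sdw in rd1 tn1 ht1.
have run1 i v : run close_step (arc_vertex p j) (take i (drop 1 w)) v ->
  run close_step x (take (1 + i) w) v.
  by move=> h; rewrite takeD; apply/run_cat; exists (arc_vertex p j).
have [a1 a2 a3 a4 a5] := rd1.
have [b1 _] : 32 * t1 < size r /\ 32 * t1 < size (loop_word p1).
  by apply: (short 1 t1 p1 j) => //; [lia|lia|exact: run1].
case: tn1 => [h|[p2 [i [c1 c2 c3 c4 [c5 c6 c7 c8]]]]]; first by lia.
rewrite -/w sdw in c6 c7 c8.
have L2 := arc_len_le c1; have L1 := arc_len_le a1.
have Rb1 : R (loop_word (loop_bar p1)) := loop_word_R (is_loop_bar a1).
have i2 : 32 * i < size (loop_word p2).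
  rewrite ltnNge; apply/negP => h; apply: c5.
  by rewrite (sc_piece SC (loop_word_R c1) Rb1 _ h c4) //; lia.
have hz2 := run1 _ _ c7; rewrite add1n in hz2.
have k2 : t1.+2 <= k by lia.
have hj2 : 0 < i.+1 < arc_len p2 by [].
have sj2 : (nth l0 (loop_word p2) i.+1).1 = (nth l0 (drop t1.+2 w) 0).1.
  by rewrite c8 !nth_drop addn0 add1n.
have [p3 [t2 [ht2 rd2 tn2]]] :=
  ride c1 hj2 (alternating_drop k t1.+2 hr) (rund _ _ hz2) (avd _ _ k2 hz2) sj2.
rewrite -/w sdw in rd2 tn2 ht2.
have run2 n v : run close_step (arc_vertex p2 i.+1) (take n (drop t1.+2 w)) v ->
  run close_step x (take (t1.+2 + n) w) v.
  by move=> h; rewrite takeD; apply/run_cat; exists (arc_vertex p2 i.+1).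
have [d1 d2 d3 d4 d5] := rd2.
have [b2 b3] : 32 * t2 < size r /\ 32 * t2 < size (loop_word p3).
  by apply: (short t1.+2 t2 p3 i.+1) => //; [lia|lia|exact: run2].
case: tn2 => [h|[p4 [i' [e1 e2 e3 e4 [e5 e6 e7 e8]]]]]; first by lia.
have L3 := arc_len_le d1; have M3 := arc_len_large d1; have L4 := arc_len_le e1.
have Rb3 : R (loop_word (loop_bar p3)) := loop_word_R (is_loop_bar d1).
have i4 : 32 * i' < size (loop_word p3).
  rewrite ltnNge -(size_loop_bar p3); apply/negP => h; apply: e5.
  by rewrite (sc_piece SC Rb3 (loop_word_R e1) _ h (esym e4)) // size_loop_bar; lia.
have i3 : 32 * i < size (loop_word p3).
  rewrite ltnNge; apply/negP => h; apply: c5.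
  have f1 : take i (loop_word p3) = take i (loop_word (loop_bar p1)).
    by rewrite -c4 -[LHS](take_takel _ (leqnSn i)) d2 take_takel.
  rewrite -(sc_piece SC (loop_word_R d1) Rb1 _ h f1); last by lia.
  by rewrite -[LHS](nth_take l0 (ltnSn i)) -d2 nth_take.
have s3 := sc_size SC (loop_word_R d1).
lia.
Qed.
End Loops.

(** * The limit of the stages *)
Section Limit.
Variables (Gam : groupType) (R : word Gam -> Prop) (pos : word Gam -> bool).
Hypothesis SC : small_cancellation R pos.

(** Names of points: the points added to stage [n] carry the tag [n], which
makes them new. *)
Inductive tree : Type := Base | Node (n : nat) (x : tree) (w : word Gam).

Fixpoint below (n : nat) (x : tree) : Prop :=
  if x is Node m y _ then m < n /\ below n y else True.

Lemma below_le m n x : m <= n -> below m x -> below n x.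
Proof.
by move=> mn; elim: x => //= k x IH _ [h1 h2]; split; [exact: leq_trans mn | exact: IH].
Qed.

Fixpoint stage (n : nat) : tree -> letter Gam -> tree -> Prop :=
  if n is m.+1 then close_step R pos (below m) (stage m) (Node m) else fun _ _ _ => False.

Lemma stage_invariant n : [/\ action (stage n),
  forall x l y, stage n x l y -> below n x &
  forall x y r k, R r -> run (stage n) x (take k r) y -> size r <= 8 * k ->
    run (stage n) x r x].
Proof.
elim: n => [|n [A B C]].
  split=> [|//|x y r [|k] hr]; first by split.
    by move=> _; have := sc_size SC hr; lia.
  by have := sc_size SC hr; case: r hr => //= l r _ _ [].
have Ninj x y u v : Node n x u = Node n y v -> x = y /\ u = v by case.
have Nfr x u : ~ below n (Node n x u) by rewrite /= ltnn => -[].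
split=> /=; first exact: close_action.
  move=> x l y [/B|[p [j [a [hp _ _ -> _]]]]]; first exact: below_le.
  have node_below z w : below n z -> below n.+1 (node (Node n) z w).
    by move=> h; case: w => [|b w] /=; [exact: below_le h | split=> //; exact: below_le h].
  by rewrite /tree_point; do 2?case: ifP => _; apply: node_below;
    [exact: entry_D hp|exact: exit_D hp|exact: exit_D hp].
exact: close_invariant.
Qed.

Lemma stage_mono m n x l y : m <= n -> stage m x l y -> stage n x l y.
Proof.
move=> mn; rewrite -(subnK mn) addnC; elim: (n - m) => [|k IH]; first by rewrite addn0.
by move=> /IH; rewrite addnS; left.
Qed.

Definition limit x l y := exists n, stage n x l y.

Lemma limit_action : action limit.
Proof.
split.
- move=> x l y y' [m h1] [n h2]; have [A _ _] := stage_invariant (maxn m n).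
  by apply: (act_det A); [apply: stage_mono h1|apply: stage_mono h2]; lia.
- move=> x s a y b z [m h1] [n h2]; exists (maxn m n); have [A _ _] := stage_invariant (maxn m n).
  by apply: (act_mul A); [apply: stage_mono h1|apply: stage_mono h2]; lia.
- move=> x s a y b [m h]; have [A _ _] := stage_invariant m.
  by have [z hz] := act_tot A b h; exists z, m.
- move=> x s y [m]; have [A _ _] := stage_invariant m; exact: (act_one A).
- move=> x s a y [m h]; have [A _ _] := stage_invariant m; exists m; exact: (act_inv A).
- move=> x s a [m]; have [A _ _] := stage_invariant m; exact: (act_free A).
Qed.

Lemma below_ex x : exists n, below n x.
Proof.
elim: x => [|k x [n IH] w]; first by exists 0.
by exists (maxn k.+1 n); split; [lia|apply: below_le IH; lia].
Qed.

Lemma limit_closed x r : R r -> run limit x r x.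
Proof.
move=> hr; have [n hn] := below_ex x; have [A B C] := stage_invariant n.
have Ninj x1 y u v : Node n x1 u = Node n y v -> x1 = y /\ u = v by case.
have Nfr x1 u : ~ below n (Node n x1 u) by rewrite /= ltnn => -[].
have := closed_D SC A B C Ninj Nfr hn hr.
by apply: run_mono => a l b h; exists n.+1.
Qed.

(** Both sides are defined everywhere, because some relator begins with a letter
of each side, and relators can be read from every point. *)
Lemma limit_total r x s : R r -> exists y, limit x (s, 1%g) y.
Proof.
have H r' : R r' -> exists y, limit x ((nth (l0 Gam) r' 0).1, 1%g) y.
  move=> hr; have := sc_size SC hr; have := limit_closed x hr.
  case: r' hr => //= -[t a] r' _ [y h _] _ /=.
  exact: (act_tot limit_action _ h).
move=> hr; have r64 := sc_size SC hr.
have := H _ hr; have := H _ (sc_rot SC 1 hr).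
rewrite /rot nth_cat size_drop subn_gt0 ifT ?nth_drop; last by lia.
rewrite (sc_alt SC hr); last by lia.
by case: s; case: (nth _ r 0).1.
Qed.
End Limit.

Theorem sc_action (Gam : groupType) (R : word Gam -> Prop) (pos : word Gam -> bool) :
  small_cancellation R pos -> (exists r, R r) ->
  exists (U : Type) (st : U -> letter Gam -> U -> Prop),
    [/\ action st, forall x r, R r -> run st x r x,
        forall x s, exists y, st x (s, 1%g) y & inhabited U].
Proof.
move=> SC [r hr]; exists (tree Gam), (limit R pos); split.
- exact: limit_action.
- by move=> x r' hr'; exact: limit_closed.
- by move=> x s; exact: (limit_total SC _ _ hr).
- exact: inhabits (Base _).
Qed.

(** * The relators, and why they satisfy small cancellation *)
Section Separators.
Variable L : nat.
Hypothesis L_big : 32 * 64 <= L.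

(** Positions of the separators of the relator number [n].  Its gaps are
[L * n.+1 + m] for [m < L]: by division by [L], a gap determines both [n] and
[m], and successive gaps of a relator increase by one. *)
Fixpoint sep_at (n m : nat) : nat :=
  if m is m'.+1 then sep_at n m' + (L * n.+1 + m') else 1.

Definition npairs n := (sep_at n L).+1.
Definition is_sep n u := has (fun m => u == sep_at n m) (iota 0 L.+1).

Lemma is_sepP n u : reflect (exists2 m, m <= L & u = sep_at n m) (is_sep n u).
Proof.
apply: (iffP hasP) => [[m]|[m mL ->]].
  by rewrite mem_iota => /andP[_ mL] /eqP ->; exists m.
by exists m; rewrite // mem_iota.
Qed.

Lemma gap_ge n m : 3 <= L * n.+1 + m.
Proof. by rewrite mulnS; lia. Qed.

Lemma sep_at_ltn n a b : (sep_at n a < sep_at n b) = (a < b).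
Proof.
have H : {homo sep_at n : x y / x < y >-> x < y}.
  by apply: homo_ltn => [y x z|m]; [exact: ltn_trans | have := gap_ge n m => /=; lia].
case: (ltngtP a b) => [/H -> //|/H h|->]; last by rewrite ltnn.
by rewrite ltnNge (ltnW h).
Qed.

Lemma sep_at_inj n : injective (sep_at n).
Proof.
move=> a b e; case: (ltngtP a b) => // h; have := h; rewrite -(sep_at_ltn n) e ltnn //.
Qed.

Lemma gap_inj n n' m m' : m < L -> m' < L -> L * n.+1 + m = L * n'.+1 + m' -> n = n' /\ m = m'.
Proof.
move=> h h' e; have L0 : 0 < L by lia.
have := congr1 (fun k => k %/ L) e; have := congr1 (fun k => k %% L) e.
rewrite !(mulnC L) !modnMDl !modn_small // => ->.
by rewrite !divnMDl // !divn_small // !addn0 => -[->].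
Qed.

Lemma consecutive n v v' : is_sep n v -> is_sep n v' -> v < v' ->
  (forall u, v < u < v' -> ~~ is_sep n u) ->
  exists2 a, a < L & v = sep_at n a /\ v' = sep_at n a.+1.
Proof.
move=> /is_sepP[a aL ->] /is_sepP[b bL ->]; rewrite sep_at_ltn => ab H.
exists a; first by lia.
split=> //; congr sep_at; apply/eqP; rewrite eqn_leq ab andbT leqNgt; apply/negP => h.
have /negP[] : ~~ is_sep n (sep_at n a.+1) by apply: H; rewrite !sep_at_ltn; lia.
by apply/is_sepP; exists a.+1; lia.
Qed.

Lemma sep_gap n m u : m < L -> sep_at n m < u < sep_at n m.+1 -> ~~ is_sep n u.
Proof.
by move=> mL /andP[h1 h2]; apply/is_sepP => -[k kL e]; move: h1 h2; rewrite e !sep_at_ltn; lia.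
Qed.

Lemma sep_adj n u : is_sep n u -> ~~ is_sep n u.+1.
Proof.
move=> /is_sepP[a aL ->]; apply/is_sepP => -[b bL e].
have : a < b by rewrite -(sep_at_ltn n); lia.
move=> ab; have : sep_at n a.+1 <= sep_at n b.
  by rewrite leqNgt sep_at_ltn; lia.
by have := gap_ge n a => /=; lia.
Qed.

(** At most one gap is lost before the first separator of the stretch, and two
more fit after it. *)
Lemma window n a e : 0 < a -> e < npairs n -> a + 3 * (L * n.+1 + L) < e ->
  exists m, [/\ m.+1 < L, a <= sep_at n m & sep_at n m.+2 < e].
Proof.
move=> a0 eN ae.
have aL : a <= sep_at n L by move: eN; rewrite /npairs; lia.
have ex : exists m, a <= sep_at n m by exists L.
have [m hm mmin] := ex_minnP ex.
have mL : m <= L by exact: mmin.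
have ub : sep_at n m <= a + (L * n.+1 + L).
  case: m hm mmin mL => [|m] hm mmin mL /=; first by lia.
  have : ~~ (a <= sep_at n m) by apply/negP => /mmin; lia.
  by lia.
have mL2 : m.+1 < L.
  rewrite ltnNge; apply/negP => h.
  have m_or : m = L \/ m.+1 = L by lia.
  move: eN; rewrite /npairs; case: m_or => e1; first by rewrite -e1; lia.
  by rewrite -e1 /=; lia.
by exists m; split=> //=; lia.
Qed.

(** The relator with index [i] says that the letter [rg i] is a word in [rx i],
on the side [rs i], and in [rb1 i] and [rb2 i], on the other side. *)
Record rel_index (Gam : groupType) := RelIndex {
  rs : bool; rx : Gam; rb1 : Gam; rb2 : Gam; rg : letter Gam }.

Record valid (Gam : groupType) (i : rel_index Gam) : Prop := Valid {
  rx_neq1 : rx i <> 1%g;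
  rb1_neq1 : rb1 i <> 1%g;
  rb2_neq1 : rb2 i <> 1%g;
  rb_neq : rb1 i <> rb2 i;
  rg_neq1 : (rg i).2 <> 1%g }.

Variables (Gam : groupType) (code : rel_index Gam -> nat).
Hypothesis code_inj : injective code.

Definition run_letter (i : rel_index Gam) u := if is_sep (code i) u then rb2 i else rb1 i.

Definition regular_letter (i : rel_index Gam) v : letter Gam :=
  if odd v then (~~ rs i, run_letter i v./2) else (rs i, rx i).
Definition shift_index (neg : bool) w k := if neg then w - k else w + k.
Definition orient (neg : bool) (l : letter Gam) := if neg then linv l else l.

(** Two relators that agree on a long window of regular letters, the second one being
read forwards or backwards, are equal, and read at the same place.  The window contains two
complete gaps of [i].  Inside a gap [rb1 i] occurs at two adjacent places, and
separators of [j] are never adjacent, so it must come from [rb1 j]; hence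
separators correspond to separators, and gaps to gaps of equal length.  One gap
of [i] thus determines [j] and the position in it.  Read backwards, two
consecutive gaps of [j] would decrease, while those of [i] increase. *)
Lemma compare i j neg v0 w0 W : valid i -> valid j ->
  2 <= v0 -> v0 + W <= 2 * npairs (code i) ->
  (forall k, k < W -> 2 <= shift_index neg w0 k < 2 * npairs (code j)) ->
  (forall k, k < W -> regular_letter i (v0 + k) =
    orient neg (regular_letter j (shift_index neg w0 k))) ->
  6 * (L * (code i).+1 + L) + 6 <= W ->
  [/\ neg = false, i = j & v0 = w0].
Proof.
move=> vi vj v2 vW wr eqs hW; set n := code i in vW hW *; set nj := code j in wr.
have [m [mL am me]] : exists m, [/\ m.+1 < L, uphalf v0 <= sep_at n m &
    sep_at n m.+2 < (v0 + W - 2)./2].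
  by apply: window; lia.
pose w u := shift_index neg w0 (u.*2.+1 - v0).
pose inW u := sep_at n m <= u <= sep_at n m.+2.
have kW u : inW u -> v0 <= u.*2.+1 /\ u.*2.+1 - v0 < W by rewrite /inW; lia.
have E u : inW u -> (~~ rs i, run_letter i u) = orient neg (regular_letter j (w u)).
  move=> /kW[h1 h2]; rewrite -eqs // subnKC // /regular_letter.
  by rewrite [odd _]/= odd_double /= uphalf_double.
have wb u : inW u -> 2 <= w u < 2 * npairs nj by move=> /kW[_ h2]; exact: wr.
have par u : inW u -> odd (w u) = ~~ (odd w0 (+) odd v0).
  move=> hu; have := wb _ hu; have := kW _ hu; rewrite /w /shift_index; case: (neg); lia.
have g0 := gap_ge n m; have g1 := gap_ge n m.+1.
have s1 : sep_at n m.+1 = sep_at n m + (L * n.+1 + m) by [].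
have s2 : sep_at n m.+2 = sep_at n m.+1 + (L * n.+1 + m.+1) by [].
have in0 : inW (sep_at n m) by rewrite /inW; lia.
have in1 : inW (sep_at n m).+1 by rewrite /inW; lia.
have in2 : inW (sep_at n m).+2 by rewrite /inW; lia.
have bi0 : run_letter i (sep_at n m) = rb2 i.
  by rewrite /run_letter ifT //; apply/is_sepP; exists m => //; lia.
have bi1 : run_letter i (sep_at n m).+1 = rb1 i.
  by rewrite /run_letter ifN //; apply: (@sep_gap n m); lia.
have bi2 : run_letter i (sep_at n m).+2 = rb1 i.
  by rewrite /run_letter ifN //; apply: (@sep_gap n m); lia.
(* If the parities disagreed, the letters of [i] at a separator and next to it
   would both be read from [rx j]. *)
case: (boolP (odd w0 (+) odd v0)) => pr.
  case: (rb_neq vi); have := E _ in0; have := E _ in1.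
  by rewrite bi0 bi1 /regular_letter !par // pr /= => <- [].
pose h u := (w u)./2.
pose tau (a : Gam) := if neg then (a^-1)%g else a.
have tauI : injective tau by rewrite /tau; case: (neg) => // a b; exact: invg_inj.
have B u : inW u -> run_letter i u = tau (run_letter j (h u)).
  move=> hu; have := E u hu; rewrite /regular_letter par // pr /orient /tau.
  by case: (neg) => /= -[].
have hw u : inW u -> w u = (h u).*2.+1.
  by move=> hu; rewrite /h -[LHS]odd_double_half par // pr.
have hadj : (h (sep_at n m).+2 = (h (sep_at n m).+1).+1) \/
    (h (sep_at n m).+1 = (h (sep_at n m).+2).+1).
  have := hw _ in1; have := hw _ in2; have := kW _ in1; have := kW _ in2.
  have := wb _ in1; have := wb _ in2; rewrite /w /shift_index; case: (neg); lia.
have ns1 : is_sep nj (h (sep_at n m).+1) = false /\ tau (rb1 j) = rb1 i.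
  have := B _ in1; have := B _ in2; rewrite bi1 bi2 /run_letter -/nj.
  case e1 : (is_sep nj (h (sep_at n m).+1)); case e2 : (is_sep nj (h (sep_at n m).+2)) => -> e.
  - by case: hadj => e3; [have := sep_adj e1; rewrite -e3 e2|have := sep_adj e2; rewrite -e3 e1].
  - by case: (rb_neq vj); exact: tauI.
  - by case: (rb_neq vj); exact/esym/tauI.
  - by [].
have [_ t1] := ns1.
have S u : inW u -> is_sep n u = is_sep nj (h u).
  move=> /B; rewrite /run_letter -/n -/nj; case: ifP; case: ifP => // _ _ e.
    by case: (rb_neq vi); rewrite e t1.
  by case: (rb_neq vj); apply: tauI; rewrite t1.
have sepi k : k <= m.+2 -> is_sep n (sep_at n k).
  by move=> km; apply/is_sepP; exists k => //; exact: leq_trans km mL.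
have in1' : inW (sep_at n m.+1) by rewrite /inW s2 s1 !leq_addr andbT.
have in2' : inW (sep_at n m.+2) by rewrite /inW s2 s1 -addnA leq_addr leqnn.
have sep0 : is_sep nj (h (sep_at n m)) by rewrite -S // sepi // -addn2 leq_addr.
have sep1 : is_sep nj (h (sep_at n m.+1)) by rewrite -S // sepi.
have sep2 : is_sep nj (h (sep_at n m.+2)) by rewrite -S // sepi.
have lin u v : inW u -> inW v -> if neg then h u + u = h v + v else h u + v = h v + u.
  move=> hu hv; have := kW _ hu; have := kW _ hv; have := hw _ hu; have := hw _ hv.
  have := wb _ hu; have := wb _ hv; rewrite /w /shift_index; case: (neg); clear; lia.
have off u : inW u -> neg = false -> w0 + u.*2.+1 = v0 + (h u).*2.+1.
  move=> hu en; have := kW _ hu; have := hw _ hu; rewrite /w /shift_index en; clear; lia.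
have Sn u : inW u -> u <> sep_at n m -> u <> sep_at n m.+1 -> u <> sep_at n m.+2 ->
    ~~ is_sep nj (h u).
  move=> hu n0 n1 n2; rewrite -S //; move: hu; rewrite /inW => hu.
  case: (ltnP u (sep_at n m.+1)) => h1.
    apply: (@sep_gap n m); first exact: ltn_trans mL.
    by rewrite h1 andbT; move: hu n0; clear; lia.
  by apply: (@sep_gap n m.+1) => //; move: hu n1 n2 h1; clear; lia.
have g1' : sep_at n m < sep_at n m.+1 by rewrite sep_at_ltn.
have g2' : sep_at n m.+1 < sep_at n m.+2 by rewrite sep_at_ltn.
case en : neg in lin off *; last first.
  have l01 := lin _ _ in0 in1'.
  have [a aL [ea ea']] : exists2 a,
    a < L & h (sep_at n m) = sep_at nj a /\ h (sep_at n m.+1) = sep_at nj a.+1.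
    apply: consecutive => //; first by move: l01 g1'; clear; lia.
    move=> u hu; pose u' := sep_at n m + (u - h (sep_at n m)).
    have hu' : sep_at n m < u' < sep_at n m.+1 by rewrite /u'; move: hu l01; clear; lia.
    have iu : inW u' by rewrite /inW; move: hu' g2'; clear; lia.
    have -> : u = h u' by have := lin _ _ iu in0; rewrite /u'; move: hu; clear; lia.
    by apply: Sn => //; move: hu' g2'; clear; lia.
  move: (ea'); rewrite [sep_at nj _]/= -ea => e3.
  have [e4 em] : n = nj /\ m = a.
    by apply: gap_inj => //; [exact: ltn_trans mL|move: e3 l01 s1; clear; lia].
  split=> //; first exact: code_inj.
  by have := off _ in0 erefl; rewrite ea -e4 -em; clear; lia.
(* Reading backwards: the two gaps of [i] give gaps number [a] and [c] of [j],
   with [a] equal to [c.+1] by position and to [c - 1] by length. *)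
exfalso; have l01 := lin _ _ in0 in1'; have l12 := lin _ _ in1' in2'.
have [a aL [ea ea']] : exists2 a,
  a < L & h (sep_at n m.+1) = sep_at nj a /\ h (sep_at n m) = sep_at nj a.+1.
  apply: consecutive => //; first by move: l01 g1'; clear; lia.
  move=> u hu; pose u' := sep_at n m.+1 - (u - h (sep_at n m.+1)).
  have hu' : sep_at n m < u' < sep_at n m.+1 by rewrite /u'; move: hu l01; clear; lia.
  have iu : inW u' by rewrite /inW; move: hu' g2'; clear; lia.
  have -> : u = h u'.
    by have := lin _ _ iu in1'; rewrite /u'; move: hu l01; clear; lia.
  by apply: Sn => //; move: hu' g2'; clear; lia.
have [c cL [ec ec']] : exists2 a,
  a < L & h (sep_at n m.+2) = sep_at nj a /\ h (sep_at n m.+1) = sep_at nj a.+1.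
  apply: consecutive => //; first by move: l12 g2'; clear; lia.
  move=> u hu; pose u' := sep_at n m.+2 - (u - h (sep_at n m.+2)).
  have hu' : sep_at n m.+1 < u' < sep_at n m.+2 by rewrite /u'; move: hu l12; clear; lia.
  have iu : inW u' by rewrite /inW; move: hu' g1'; clear; lia.
  have -> : u = h u'.
    by have := lin _ _ iu in2'; rewrite /u'; move: hu l12; clear; lia.
  by apply: Sn => //; move: hu' g1'; clear; lia.
move: (ea'); rewrite [sep_at nj _]/= -ea => e3.
have [_ em] : n = nj /\ m = a.
  by apply: gap_inj => //; [exact: ltn_trans mL|move: e3 l01 s1; clear; lia].
move: (ec'); rewrite [sep_at nj _]/= -ec => e4.
have [_ em'] : n = nj /\ m.+1 = c by apply: gap_inj => //; move: e4 l12 s2; clear; lia.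
have : a = c.+1 by apply: (@sep_at_inj nj); rewrite -ea -ec'.
by rewrite -em -em'; clear; lia.
Qed.

Definition period i := 2 * npairs (code i).
(** The first pair of letters is where [rg i] enters: its inverse takes the place
that keeps the sides alternating. *)
Definition special_letter (i : rel_index Gam) v : letter Gam :=
  if (rg i).1 == rs i then (if v == 0 then linv (rg i) else (~~ rs i, rb2 i))
  else (if v == 0 then (rs i, rx i) else linv (rg i)).
Definition rel_letter i k : letter Gam :=
  let v := k %% period i in if v < 2 then special_letter i v else regular_letter i v.

Lemma sep_at_ge n m : m * (L * n.+1) <= sep_at n m.
Proof. by elim: m => // m IH; rewrite mulSn /=; lia. Qed.

(** A part of 1/32 of a relator has room for four windows as in [compare]: the
number of gaps is [L], at least 64 times 32. *)
Lemma period_ge i t : period i <= 32 * t -> 4 * (6 * (L * (code i).+1 + L) + 6) + 6 <= t.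
Proof.
rewrite /period /npairs; have := sep_at_ge (code i) L; set a := L * _.+1 => h1 h2.
have La : L <= a by rewrite /a leq_pmulr.
have h3 : 32 * 64 * a <= L * a by rewrite leq_mul2r L_big orbT.
by lia.
Qed.

Lemma period_64 i : 64 <= period i.
Proof. by rewrite leqNgt; apply/negP => h; have := @period_ge i 2; lia. Qed.

(** The special letters are adjacent, so a short window that meets them can be
moved past them. *)
Lemma free_window N p T : 2 * T + 2 <= N ->
  exists2 c, c <= T.+1 & forall k, k < T -> 2 <= (p + c + k) %% N.
Proof.
move=> TN; case: (boolP (has (fun k => (p + k) %% N < 2) (iota 0 T))) => [/hasP[k0]|/hasPn h].
  rewrite mem_iota => /andP[_ k0T] h; exists T.+1 => // k kT.
  have -> : p + T.+1 + k = p + k0 + (T.+1 + k - k0) by lia.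
  by rewrite -modnDml modn_small; lia.
exists 0 => // k kT; rewrite addn0 leqNgt; apply: h; rewrite mem_iota; lia.
Qed.

Lemma free_local N p T k : 0 < N -> (forall k, k < T -> 2 <= (p + k) %% N) -> k < T ->
  (p + k) %% N = p %% N + k.
Proof.
move=> N0 h; elim: k => [|k IH] kT; first by rewrite !addn0.
have hk := h _ kT; have := ltn_pmod (p + k) N0; rewrite IH ?(ltnW kT) // => lt.
have e : (p + k.+1) %% N = (p %% N + k + 1) %% N.
  by rewrite addnS -[(p + k).+1]addn1 -modnDml IH ?(ltnW kT).
move: hk; rewrite e; case: (ltngtP (p %% N + k + 1) N) => [h1|h1|->]; [|lia|by rewrite modnn].
by rewrite modn_small //; lia.
Qed.

Lemma rel_letter_reg i k : 2 <= k %% period i -> rel_letter i k = regular_letter i (k %% period i).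
Proof. by rewrite /rel_letter leqNgt => /negbTE ->. Qed.

(** The common stretch contains a window that avoids the special letters of
both relators, and there [compare] applies. *)
Lemma match_same i j p q t : valid i -> valid j -> period i <= 32 * t ->
  t <= period i -> t <= period j ->
  (forall k, k < t -> rel_letter i (p + k) = rel_letter j (q + k)) ->
  i = j /\ p = q %[mod period i].
Proof.
move=> vi vj /period_ge; set W := 6 * _ + 6 => ht ti tj eqs.
have Ni0 : 0 < period i by lia.
have Nj0 : 0 < period j by lia.
have [c1 hc1 f1] := @free_window (period i) p (2 * W + 2) ltac:(lia).
have [c2 hc2 f2] := @free_window (period j) (q + c1) W ltac:(lia).
have g1 k : k < W -> 2 <= (p + (c1 + c2) + k) %% period i.
  by move=> kW; rewrite addnA -(addnA _ c2); apply: f1; lia.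
have g2 k : k < W -> 2 <= (q + (c1 + c2) + k) %% period j.
  by move=> kW; rewrite addnA; exact: f2.
set c := c1 + c2 in g1 g2 *.
have l1 k : k < W -> (p + c + k) %% period i = (p + c) %% period i + k.
  by move=> kW; exact: (free_local Ni0 g1).
have l2 k : k < W -> (q + c + k) %% period j = (q + c) %% period j + k.
  by move=> kW; exact: (free_local Nj0 g2).
have W0 : 0 < W by rewrite /W; lia.
have [] := @compare i j false ((p + c) %% period i) ((q + c) %% period j) W vi vj.
- by have := g1 0 W0; rewrite addn0.
- have := l1 W.-1 ltac:(lia); have := ltn_pmod (p + c + W.-1) Ni0; rewrite /period; lia.
- move=> k kW; rewrite /shift_index -l2 // g2 //=; exact: ltn_pmod.
- move=> k kW; rewrite /shift_index /orient -l1 // -l2 // -!rel_letter_reg ?g1 ?g2 //.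
  by rewrite -!addnA; apply: eqs; lia.
- by rewrite /W.
move=> _ e; subst j => /eqP; rewrite eqn_modDr => /eqP e; by split.
Qed.

(** As in [match_same], but the second relator is read backwards, from [q] down;
[t <= q.+1] makes the subtraction in [q - k] exact. *)
Lemma match_opposite i j p q t : valid i -> valid j -> period i <= 32 * t ->
  t <= period i -> t <= period j -> t <= q.+1 ->
  (forall k, k < t -> rel_letter i (p + k) = linv (rel_letter j (q - k))) -> False.
Proof.
move=> vi vj /period_ge; set W := 6 * _ + 6 => ht ti tj tq eqs.
have Ni0 : 0 < period i by lia.
have Nj0 : 0 < period j by lia.
have [c1 hc1 f1] := @free_window (period i) p (2 * W + 2) ltac:(lia).
have [c' hc' f2] := @free_window (period j) (q - c1 - (2 * W + 1)) W ltac:(lia).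
set q' := q - c1 - (2 * W + 1) + c' in f2.
pose c2 := W + 2 - c'.
have g1 k : k < W -> 2 <= (p + (c1 + c2) + k) %% period i.
  by move=> kW; rewrite addnA -(addnA _ c2); apply: f1; rewrite /c2; lia.
set c := c1 + c2 in g1 *.
have hc : c <= 3 * W + 5 by rewrite /c /c2; lia.
have l1 k : k < W -> (p + c + k) %% period i = (p + c) %% period i + k.
  by move=> kW; exact: (free_local Ni0 g1).
have l2 k : k < W -> (q' + k) %% period j = q' %% period j + k.
  by move=> kW; exact: (free_local Nj0 f2).
have W0 : 0 < W by rewrite /W; lia.
have qk k : k < W -> q - (c + k) = q' + (W.-1 - k) by rewrite /q' /c /c2; lia.
have l3 k : k < W -> (q - (c + k)) %% period j = q' %% period j + W.-1 - k.
  by move=> kW; rewrite qk // l2; lia.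
have g3 k : k < W -> 2 <= (q - (c + k)) %% period j.
  by move=> kW; rewrite qk //; apply: f2; lia.
have [] // := @compare i j true ((p + c) %% period i) (q' %% period j + W.-1) W vi vj.
- by have := g1 0 W0; rewrite addn0.
- have := l1 W.-1 ltac:(lia); have := ltn_pmod (p + c + W.-1) Ni0; rewrite /period; lia.
- move=> k kW; rewrite /shift_index -l3 // g3 //=; exact: ltn_pmod.
- move=> k kW; rewrite /shift_index /orient -l1 // -l3 // -!rel_letter_reg ?g1 ?g3 //.
  by rewrite -!addnA; apply: eqs; lia.
Qed.

Definition rotated_relator i p : word Gam := mkseq (fun k => rel_letter i (p + k)) (period i).
Definition posrel (r : word Gam) : Prop := exists i p, valid i /\ r = rotated_relator i p.
Definition relator (r : word Gam) : Prop := posrel r \/ posrel (winv r).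

Lemma rel_letter_mod i k : rel_letter i (k %% period i) = rel_letter i k.
Proof. by rewrite /rel_letter modn_mod. Qed.

Lemma rel_letter_eqmod i j k : j = k %[mod period i] -> rel_letter i j = rel_letter i k.
Proof. by move=> e; rewrite -rel_letter_mod e rel_letter_mod. Qed.

Lemma size_rotated i p : size (rotated_relator i p) = period i.
Proof. by rewrite size_mkseq. Qed.

Lemma nth_rotated i p k : k < period i ->
  nth (l0 Gam) (rotated_relator i p) k = rel_letter i (p + k).
Proof. by move=> h; rewrite nth_mkseq. Qed.

Lemma rotated_eqmod i p q : p = q %[mod period i] -> rotated_relator i p = rotated_relator i q.
Proof.
move=> e; apply: eq_mkseq => k; apply: rel_letter_eqmod; apply/eqP.
by rewrite eqn_modDr; apply/eqP.
Qed.

Lemma rot_rotated i p n : n <= period i -> rot n (rotated_relator i p) = rotated_relator i (p + n).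
Proof.
move=> h; apply: (@eq_from_nth _ (l0 Gam)); rewrite size_rot !size_rotated // => k hk.
rewrite nth_rotated // /rot nth_cat size_drop size_rotated; case: ltnP => h2.
  by rewrite nth_drop nth_rotated ?addnA //; lia.
rewrite nth_take ?nth_rotated; try lia.
apply: rel_letter_eqmod; rewrite -(modnDr (p + _)); congr (_ %% _); lia.
Qed.

Lemma posrel_rot n r : posrel r -> posrel (rot n r).
Proof.
move=> [i [p [vi ->]]]; case: (leqP n (period i)) => h.
  by exists i, (p + n); rewrite rot_rotated.
by exists i, p; rewrite rot_oversize // size_rotated ltnW.
Qed.

Lemma winv_rot n (r : word Gam) : n <= size r -> winv (rot n r) = rot (size r - n) (winv r).
Proof.
move=> h; rewrite -{3}(cat_take_drop n r) winv_cat /rot winv_cat.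
by rewrite -size_drop -(size_winv (drop n r)) drop_size_cat // take_size_cat.
Qed.

Lemma posrel_winv_rot n r : posrel (winv r) -> posrel (winv (rot n r)).
Proof.
move=> h; case: (leqP n (size r)) => hn; first by rewrite winv_rot //; exact: posrel_rot.
by rewrite rot_oversize // ltnW.
Qed.

Lemma nth_winv_rotated r j q k : winv r = rotated_relator j q -> k < period j ->
  size r = period j /\ nth (l0 Gam) r k = linv (rel_letter j (q + (period j).-1 - k)).
Proof.
move=> e hk; have sr : size r = period j by rewrite -size_winv e size_rotated.
split=> //; rewrite -(winvK r) nth_winv ?size_winv ?sr // e nth_rotated; last by lia.
by congr (linv (rel_letter _ _)); lia.
Qed.

(** Otherwise a relator read forwards would agree with one read backwards over
its whole length, against [match_opposite]. *)
Lemma posrel_excl r : posrel r -> posrel (winv r) -> False.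
Proof.
move=> [i [p [vi e]]] [j [q [vj ej]]].
have N64 := period_64 j.
have sj : size r = period j by rewrite -size_winv ej size_rotated.
have si : size r = period i by rewrite e size_rotated.
apply: (@match_opposite i j p (q + (period j).-1) (period i)) => //; try lia.
move=> k hk; rewrite -nth_rotated // -e.
by have [_ ->] := nth_winv_rotated (k := k) ej ltac:(lia).
Qed.

Lemma rel_letter_side i k : (rel_letter i k).1 = (if odd k then ~~ rs i else rs i).
Proof.
have ev : odd (period i) = false by rewrite /period; lia.
have <- : odd (k %% period i) = odd k.
  by rewrite [in RHS](divn_eq k (period i)) oddD oddM ev andbF.
rewrite /rel_letter; case: ifP => h; last by rewrite /regular_letter; case: ifP.
rewrite /special_letter; have : k %% period i = 0 \/ k %% period i = 1 by lia.
case: eqP => e [->|->] //=; rewrite ?e //.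
by case: (rg i).1 e; case: (rs i).
Qed.

Lemma linv_neq1 (l : letter Gam) : l.2 <> 1%g -> (linv l).2 <> 1%g.
Proof. by move=> h /= e; apply: h; apply: invg_inj; rewrite e invg1. Qed.

Lemma rel_letter_neq1 i k : valid i -> (rel_letter i k).2 <> 1%g.
Proof.
move=> [h1 h2 h3 h4 h5]; have h6 := linv_neq1 h5; rewrite /rel_letter; case: ifP => _.
  by rewrite /special_letter; case: eqP => _; case: eqP => _.
by rewrite /regular_letter /run_letter; case: ifP => // _; case: ifP.
Qed.

Theorem relator_small_cancellation :
  small_cancellation relator (fun r => `[< posrel r >]).
Proof.
have sz r : relator r -> exists i, size r = period i.
  case=> -[i [p [_ e]]]; exists i; first by rewrite e size_rotated.
  by rewrite -size_winv e size_rotated.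
have rr n r : relator r -> relator (rot n r).
  by case=> h; [left; exact: posrel_rot|right; exact: posrel_winv_rot].
split=> //.
- by move=> r /sz[i ->]; exact: period_64.
- by move=> r [h|h]; [right; rewrite winvK|left].
- move=> n r hr; apply: asbool_equiv_eq; split; last exact: posrel_rot.
  move=> h; case: hr => // hr; case: (posrel_excl h); exact: posrel_winv_rot.
- move=> r hr; rewrite -asbool_neg; apply: asbool_equiv_eq; split.
    by move=> h1 h2; exact: posrel_excl h2 h1.
  by case: hr.
- move=> r k [[i [p [vi e]]]|[i [p [vi e]]]].
    rewrite e size_rotated => hk; rewrite !nth_rotated //; last exact: ltnW.
    by rewrite !rel_letter_side addnS /=; case: (odd _); rewrite ?negbK.
  have sr : size r = period i by rewrite -size_winv e size_rotated.
  rewrite sr => hk; have [_ ->] := nth_winv_rotated e hk;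
    have [_ ->] := nth_winv_rotated e (ltnW hk).
  rewrite /= !rel_letter_side; have ->
    : p + (period i).-1 - k = (p + (period i).-1 - k.+1).+1 by lia.
  by rewrite /=; case: (odd _); rewrite ?negbK.
- move=> r k [[i [p [vi e]]]|[i [p [vi e]]]].
    by rewrite e size_rotated => hk; rewrite nth_rotated //; exact: rel_letter_neq1.
  have sr : size r = period i by rewrite -size_winv e size_rotated.
  rewrite sr => hk; have [_ ->] := nth_winv_rotated e hk; exact/linv_neq1/rel_letter_neq1.
move=> r r' t hr hr' tr tr32 et.
have tr' : t <= size r'.
  by have := congr1 size et; rewrite size_takel // size_take_min; lia.
have en k : k < t -> nth (l0 Gam) r k = nth (l0 Gam) r' k.
  by move=> kt; rewrite -(nth_take _ kt) et nth_take.
case: hr => -[i [p [vi e]]]; case: hr' => -[j [q [vj e']]].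
- move: tr tr32 tr'; rewrite e e' !size_rotated => h1 h2 h3.
  have [|ij pq] := @match_same i j p q t vi vj h2 h1 h3.
    by move=> k kt; rewrite -!nth_rotated ?(leq_trans kt) // -e -e' en.
  by subst j; exact: rotated_eqmod.
- have [sj _] := nth_winv_rotated (k := 0) e' ltac:(have := period_64 j; lia).
  move: tr tr32 tr'; rewrite sj e !size_rotated => h1 h2 h3.
  case: (@match_opposite i j p (q + (period j).-1) t) => //; first by lia.
  move=> k kt; rewrite -nth_rotated ?(leq_trans kt) // -e en //.
  by have [_ ->] := nth_winv_rotated (k := k) e' (leq_trans kt h3).
- have [si _] := nth_winv_rotated (k := 0) e ltac:(have := period_64 i; lia).
  move: tr tr32 tr'; rewrite si e' !size_rotated => h1 h2 h3.
  case: (@match_opposite i j (p + period i - t) (q + t.-1) t) => //; first by lia.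
  move=> k kt; have k't : t.-1 - k < t by lia.
  have := en _ k't; have [_ ->] := nth_winv_rotated e (leq_trans k't h1).
  rewrite e' nth_rotated ?(leq_trans k't) // => /(congr1 (@linv _)); rewrite linvK.
  have -> : p + (period i).-1 - (t.-1 - k) = p + period i - t + k by lia.
  by move=> ->; congr (linv (rel_letter _ _)); lia.
- have [si _] := nth_winv_rotated (k := 0) e ltac:(have := period_64 i; lia).
  have [sj _] := nth_winv_rotated (k := 0) e' ltac:(have := period_64 j; lia).
  move: tr tr32 tr'; rewrite si sj => h1 h2 h3.
  have [|ij pq] := @match_same i j (p + period i - t) (q + period j - t) t vi vj h2 h1 h3.
    move=> k kt; have k't : t.-1 - k < t by lia.
    have := en _ k't; have [_ ->] := nth_winv_rotated e (leq_trans k't h1).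
    have [_ ->] := nth_winv_rotated e' (leq_trans k't h3) => /(congr1 (@linv _)); rewrite !linvK.
    have -> : p + (period i).-1 - (t.-1 - k) = p + period i - t + k by lia.
    by have -> : q + (period j).-1 - (t.-1 - k) = q + period j - t + k by lia.
  subst j; apply: (can_inj (@winvK Gam)); rewrite e e'; apply: rotated_eqmod.
  apply/eqP; rewrite -(eqn_modDr (period i - t)) !addnBA //; exact/eqP.
Qed.
End Separators.

Local Open Scope classical_set_scope.

(** * Groups in which the relations hold *)
Section Homs.
Local Open Scope group_scope.
Variables (G H : groupType) (f : G -> H).
Hypothesis fM : forall x y, f (x * y) = f x * f y.

Lemma hom1 : f 1 = 1.
Proof. by apply: (mulgI (f 1)); rewrite -fM !mulg1. Qed.

Lemma homV x : f x^-1 = (f x)^-1.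
Proof. by apply: (mulgI (f x)); rewrite -fM !mulgV hom1. Qed.

Lemma homX x n : f (x ^+ n) = f x ^+ n.
Proof. by elim: n => [|n IH]; rewrite ?hom1 // !expgS fM IH. Qed.

Lemma hom_order x p : injective f -> has_order x p -> has_order (f x) p.
Proof.
move=> fI; have e m : f x ^+ m = 1 -> x ^+ m = 1 by rewrite -homX -hom1 => /fI.
case: p => [n|] /=; last by move=> h m m0 /e; exact: h.
by case=> h1 h2 h3; split=> //; [rewrite -homX h2 hom1 | move=> m /h3 h /e].
Qed.
End Homs.

Section Subgroups.
Local Open Scope group_scope.
Variable G : groupType.
Implicit Type H : set G.

Lemma subgroupP H : subgroup H <-> H 1 /\ forall x y, H x -> H y -> H (x * y^-1).
Proof.
split=> [[h1 h2]|[h1 h2]]; split.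
- exact: set_mem.
- by move=> x y hx hy; apply: set_mem; apply: h2; exact: mem_set.
- exact: mem_set.
- by move=> x y /set_mem hx /set_mem hy; apply: mem_set; exact: h2.
Qed.

Lemma subgroupV H x : subgroup H -> H x -> H x^-1.
Proof. by move=> /subgroupP[h1 h2] /(h2 _ _ h1); rewrite mul1g. Qed.

Lemma subgroupM H x y : subgroup H -> H x -> H y -> H (x * y).
Proof.
move=> sH hx /(subgroupV sH) hy; have /subgroupP[_ h2] := sH.
by have := h2 _ _ hx hy; rewrite invgK.
Qed.

Lemma generated_subgroup (A : set G) : subgroup (generated A).
Proof.
apply/subgroupP; split=> [M [/subgroupP[]] //|x y hx hy M hM].
have /subgroupP[_ h] := hM.1; apply: h; [exact: hx|exact: hy].
Qed.

Lemma generated_sub (A : set G) x : A x -> generated A x.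
Proof. by move=> Ax M [_ AM]; exact: AM. Qed.
End Subgroups.

Section Model.
Local Open Scope group_scope.
Variables (L : nat) (Gam : groupType) (code : rel_index Gam -> nat).
Hypothesis L_big : 32 * 64 <= L.

(** A homomorphism from the free product of two copies of [Gam] that satisfies
the relations, given by its values on letters. *)
Record model (S : groupType) (io : letter Gam -> S) : Prop := Model {
  io_mul : forall s a b, io (s, a * b) = io (s, a) * io (s, b);
  io_rel : forall i, valid i -> \prod_(l <- rotated_relator L code i 0) io l = 1 }.

(** All letters of the relator but one have their image in [H], and that one is
the inverse of [rg i]. *)
Lemma rel_gen (S : groupType) (io : letter Gam -> S) (H : set S) i :
  model io -> valid i -> subgroup H ->
  H (io (rs i, rx i)) -> H (io (~~ rs i, rb1 i)) -> H (io (~~ rs i, rb2 i)) -> H (io (rg i)).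
Proof.
move=> M vi sH h1 h2 h3.
have ioV l : io (linv l) = (io l)^-1.
  by case: l => s a; exact: (homV (io_mul M s)).
have p2 : 2 < period L code i by apply: leq_trans (period_64 L_big code i).
have ec : rotated_relator L code i 0 = [:: rel_letter L code i 0, rel_letter L code i 1 &
    [seq rel_letter L code i k | k <- iota 2 (period L code i - 2)]].
  by rewrite /rotated_relator /mkseq -{1}(subnKC (ltnW p2)).
have := io_rel M vi; rewrite ec !big_cons; set w := \prod_(l <- _) _.
have hw : H w.
  rewrite /w big_map big_seq; apply: (big_ind H) => [|x y|k].
  - by have /subgroupP[] := sH.
  - exact: subgroupM.
  rewrite mem_iota => hk; have e : k %% period L code i = k by rewrite modn_small; lia.
  rewrite rel_letter_reg e; last by lia.
  by rewrite /regular_letter /run_letter; case: ifP => _ //; case: ifP.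
rewrite /rel_letter !modn_small; try lia.
rewrite /= /special_letter /=; case: eqP => e.
  rewrite ioV => h; have -> : io (rg i) = io (~~ rs i, rb2 i) * w.
    by apply: (mulgI (io (rg i))^-1); rewrite mulVg h.
  exact: subgroupM.
rewrite ioV => h; have -> : io (rg i) = w * io (rs i, rx i).
  apply: (mulgI (io (rg i))^-1); rewrite mulVg.
  by apply: (mulgI (io (rs i, rx i))); rewrite mulg1 !mulgA -(mulgA _ _ w) h mul1g.
exact: subgroupM.
Qed.

Variables (S : groupType) (io : letter Gam -> S).
Hypothesis M : model io.

Lemma model_gen s x b1 b2 (H : set S) :
  x <> 1 -> b1 <> 1 -> b2 <> 1 -> b1 <> b2 -> subgroup H ->
  H (io (s, x)) -> H (io (~~ s, b1)) -> H (io (~~ s, b2)) -> forall l, H (io l).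
Proof.
move=> x1 b11 b21 b12 sH h1 h2 h3 l; case: (pselect (l.2 = 1)) => l1.
  case: l l1 => t a /= ->; rewrite (hom1 (io_mul M t)).
  by have /subgroupP[] := sH.
exact: (@rel_gen _ _ _ (RelIndex s x b1 b2 l) M).
Qed.

(** Since [x] dies, the powers of [c] on the other side form a subgroup that
contains the generators [x], [c], [c ^+ 2] of [model_gen]. *)
Lemma model_pow s (x c : Gam) n : x <> 1 -> io (s, x) = 1 -> c <> 1 -> c ^+ 2 <> 1 ->
  c ^+ n.+1 = 1 -> forall l, io l ^+ n.+1 = 1.
Proof.
move=> x1 ix c1 c2 cn.
have c12 : c <> c ^+ 2.
  by move=> e; apply: c1; apply: (mulgI c); rewrite mulg1 {3}e expgS expg1.
pose H : set S := fun y => exists k, y = io (~~ s, c ^+ k).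
have sH : subgroup H.
  apply/subgroupP; split; first by exists 0%N; rewrite expg0 (hom1 (io_mul M _)).
  move=> _ _ [k ->] [m ->]; exists (k + m * n)%N.
  rewrite -(homV (io_mul M _)) -io_mul //; congr (io (_, _)).
  rewrite expgnDr; congr (_ * _); apply: (mulgI (c ^+ m)); rewrite mulgV -expgnDr.
  by rewrite -mulnS mulnC expgnA cn expg1n.
have h l : H (io l).
  apply: (@model_gen s x c (c ^+ 2)) => //.
  - by exists 0%N; rewrite expg0 (hom1 (io_mul M _)).
  - by exists 1%N; rewrite expg1.
  - by exists 2.
move=> l; have [k ->] := h l.
by rewrite -(homX (io_mul M _)) -expgnA mulnC expgnA cn expg1n (hom1 (io_mul M _)).
Qed.

(** By [model_pow] every letter has third and fifth power 1, and 6 = 5 + 1. *)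
Lemma model_kill s (x c d : Gam) : x <> 1 -> io (s, x) = 1 ->
  c <> 1 -> c ^+ 3 = 1 -> d <> 1 -> d ^+ 5 = 1 -> forall l, io l = 1.
Proof.
move=> x1 ix c1 c3 d1 d5 l.
have c2 : c ^+ 2 <> 1 by move=> e; apply: c1; move: c3; rewrite expgS e mulg1.
have d2 : d ^+ 2 <> 1.
  by move=> e; apply: d1; move: d5; rewrite (expgnDr d 1 4) (expgnA d 2 2) e expg1n mulg1 expg1.
have e3 := model_pow x1 ix c1 c2 c3 l; have e5 := model_pow x1 ix d1 d2 d5 l.
have : io l ^+ 6 = 1 by rewrite (expgnA _ 3 2) e3 expg1n.
by rewrite expgSr e5 mul1g.
Qed.
End Model.

(** * A simple quotient *)
Section Quotient.
Variable Gam : groupType.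
Local Open Scope quotient_scope.
Implicit Types u v w : word Gam.

(** The congruences on words that contain the relations of the free product:
their quotients are the quotients of that group. *)
Record cong (E : word Gam -> word Gam -> Prop) : Prop := Cong {
  cong_refl : forall u, E u u;
  cong_sym : forall u v, E u v -> E v u;
  cong_trans : forall u v w, E u v -> E v w -> E u w;
  cong_cat : forall u u' v v', E u u' -> E v v' -> E (u ++ v) (u' ++ v');
  cong_mul : forall s a b, E [:: (s, a); (s, b)] [:: (s, (a * b)%g)];
  cong_one : forall s, E [:: (s, 1%g)] [::] }.

Variables (E : word Gam -> word Gam -> Prop) (cE : cong E).

Lemma cong_winv u : E (winv u ++ u) [::].
Proof.
elim: u => [|[s a] u IH]; first exact: cong_refl.
rewrite /winv /= rev_cons -cats1 -catA -[rev _]/(winv u) /=.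
apply: (cong_trans cE) IH; apply: cong_cat => //; first exact: cong_refl.
rewrite -[X in E X]/([:: (s, a^-1)%g; (s, a)] ++ u) -[X in E _ X]/([::] ++ u).
apply: cong_cat => //; last exact: cong_refl.
by apply: (cong_trans cE) (cong_one cE s); have := cong_mul cE s a^-1%g a; rewrite mulVg.
Qed.

Lemma winv_cong u : E (u ++ winv u) [::].
Proof. by have := cong_winv (winv u); rewrite winvK. Qed.

Definition eqE u v : bool := `[< E u v >].

Lemma eqE_refl : reflexive eqE.
Proof. by move=> u; apply/asboolP; exact: cong_refl. Qed.
Lemma eqE_sym : symmetric eqE.
Proof. by move=> u v; apply: asbool_equiv_eq; split; exact: cong_sym. Qed.
Lemma eqE_trans : transitive eqE.
Proof. by move=> v u w /asboolP h1 /asboolP h2; apply/asboolP; exact: cong_trans h2. Qed.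

Definition relE := EquivRel eqE eqE_refl eqE_sym eqE_trans.
Definition quot : Type := {eq_quot relE}.
HB.instance Definition _ := Choice.on quot.

Definition cls u : quot := \pi_({eq_quot relE}) u.
Definition rep (x : quot) : word Gam := repr (x : {eq_quot relE}).

Lemma cls_eq u v : cls u = cls v <-> E u v.
Proof. by split=> [/eqmodP/asboolP|h] //; apply/eqmodP/asboolP. Qed.

Lemma repK x : cls (rep x) = x.
Proof. exact: reprK. Qed.

Lemma rep_cls u : E (rep (cls u)) u.
Proof. by apply/cls_eq; rewrite repK. Qed.

Definition qmul x y := cls (rep x ++ rep y).
Definition qone := cls [::].
Definition qinv x := cls (winv (rep x)).

Lemma qmul_cls u v : qmul (cls u) (cls v) = cls (u ++ v).
Proof. by apply/cls_eq; apply: cong_cat => //; exact: rep_cls. Qed.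

Fact qmulA : associative qmul.
Proof.
by move=> x y z; rewrite -(repK x) -(repK y) -(repK z) !qmul_cls catA.
Qed.
Fact qmul1 : left_id qone qmul.
Proof. by move=> x; rewrite -(repK x) qmul_cls. Qed.
Fact qmulr1 : right_id qone qmul.
Proof. by move=> x; rewrite -(repK x) qmul_cls cats0. Qed.
Fact qmulV : left_inverse qone qinv qmul.
Proof. by move=> x; rewrite -{2}(repK x) qmul_cls; apply/cls_eq/cong_winv. Qed.
Fact qmulrV : right_inverse qone qinv qmul.
Proof. by move=> x; rewrite -{1}(repK x) qmul_cls; apply/cls_eq/winv_cong. Qed.

HB.instance Definition _ := isGroup.Build quot qmulA qmul1 qmulr1 qmulV qmulrV.

Lemma clsM u v : (cls u * cls v)%g = cls (u ++ v).
Proof. exact: qmul_cls. Qed.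

Lemma cls_prod u : cls u = (\prod_(l <- u) cls [:: l])%g.
Proof.
elim: u => [|l u IH]; first by rewrite big_nil.
by rewrite big_cons -IH clsM.
Qed.
End Quotient.

Section MaximalCongruence.
Variables (Gam : groupType) (E0 : word Gam -> word Gam -> Prop).
Hypothesis cE0 : cong E0.
Variable k : letter Gam.
Hypothesis E0k : ~ E0 [:: k] [::].

(** Zorn's lemma is applied to sets of pairs to which [E0] is adjoined, so that
the empty chain is bounded by [E0] itself. *)
Lemma max_cong : exists E, [/\ cong E, (forall u v, E0 u v -> E u v), ~ E [:: k] [::] &
  forall E', cong E' -> (forall u v, E u v -> E' u v) -> ~ E' [:: k] [::] ->
    forall u v, E' u v -> E u v].
Proof.
pose rel (A : set (word Gam * word Gam)) u v := A (u, v) \/ E0 u v.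
pose P := [set A | cong (rel A) /\ ~ rel A [:: k] [::]].
have [F FP Ftot|A [[cA nA] Amax]] := @Zorn_bigcup _ P.
  set V := \bigcup_(X in F) X.
  have two u v u' v' : rel V u v -> rel V u' v' -> exists E, [/\ cong E,
      (forall w w', E w w' -> rel V w w'), E u v & E u' v'].
    have inF X : F X -> cong (rel X) /\ forall w w', rel X w w' -> rel V w w'.
      move=> FX; split=> [|w w' [Xw|]]; [by have [] := FP _ FX|by left; exists X|by right].
    move=> [[X FX Xu]|e] [[Y FY Yu]|e'].
    - case: (Ftot X Y FX FY) => XY.
        have [c s] := inF _ FY; exists (rel Y); split=> //; left; [exact: XY|by []].
      have [c s] := inF _ FX; exists (rel X); split=> //; left; [by []|exact: XY].
    - by have [c s] := inF _ FX; exists (rel X); split=> //; [left|right].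
    - by have [c s] := inF _ FY; exists (rel Y); split=> //; [right|left].
    - by exists E0; split=> // w w'; right.
  split; last by case=> [[X FX Xk]|//]; have [_] := FP _ FX; apply; left.
  split=> [u|u v h|u v w h1 h2|u u' v v' h1 h2|s a b|s].
  - by right; exact: cong_refl.
  - have [E [cE sE h' _]] := two _ _ _ _ h h; apply: sE; exact: cong_sym.
  - have [E [cE sE h1' h2']] := two _ _ _ _ h1 h2; apply: sE; exact: (cong_trans cE) h2'.
  - have [E [cE sE h1' h2']] := two _ _ _ _ h1 h2; apply: sE; exact: cong_cat.
  - by right; exact: cong_mul.
  - by right; exact: cong_one.
exists (rel A); split=> // [u v h|E' cE' sE' nE' u v h]; first by right.
apply: contrapT => nuv.
apply: (Amax [set x | E' x.1 x.2]).
  split=> [[w w'] Aw|sub]; first by apply: sE'; left.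
  by apply: nuv; left; exact: sub.
have -> : P [set x | E' x.1 x.2] = (cong E' /\ ~ E' [:: k] [::]); last by [].
rewrite /P /=; suff -> : rel [set x | E' x.1 x.2] = E' by [].
apply/funext => w; apply/funext => w'; apply/propext; split; last by left.
by case=> // h'; apply: sE'; right.
Qed.
End MaximalCongruence.

Section Simple.
Variables (L : nat) (Gam : groupType) (code : rel_index Gam -> nat).
Hypotheses (L_big : 32 * 64 <= L) (code_inj : injective code).
Variables c d : Gam.
Hypotheses (c1 : c <> 1%g) (c3 : (c ^+ 3 = 1)%g) (d1 : d <> 1%g) (d5 : (d ^+ 5 = 1)%g).

Let k : letter Gam := (true, c).

(** The congruence is the kernel of the action given by [sc_action], in which
[c] moves every point because a side acts freely. *)
Lemma base_cong : exists E0, [/\ @cong Gam E0, ~ E0 [:: k] [::] &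
  forall i, valid i -> E0 (rotated_relator L code i 0) [::]].
Proof.
have SC := relator_small_cancellation L_big code_inj.
have rel_rotated i : valid i -> relator L code (rotated_relator L code i 0) by left; exists i, 0.
have c2 : c <> (c ^+ 2)%g.
  by move=> e; apply: c1; apply: (mulgI c); rewrite mulg1 -expg2 -e.
have c21 : (c ^+ 2)%g <> 1%g.
  by move=> e; apply: c1; move: c3; rewrite expgS e mulg1.
have v0 : valid (RelIndex true c c (c ^+ 2)%g k) by split.
have [U [st [A cl tot [x0]]]] := sc_action SC (ex_intro _ _ (rel_rotated _ v0)).
exists (fun u v => forall x y, run st x u y <-> run st x v y); split.
- split=> [u|u v h|u v w h1 h2|u u' v v' h1 h2|s a b|s] x y //.
  + by rewrite h.
  + by rewrite h1 h2.
  + by split=> /run_cat[z /h1 hz /h2 hy]; apply/run_cat; exists z.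
  + split=> /=.
      by case=> z h1 [t h2 <-]; exists t => //; exact: act_mul h2.
    case=> t h1 <-; have [z hz] := tot x s.
    have [z' hz'] := act_tot A a hz; exists z' => //.
    have [t' ht'] := act_tot A b (act_inv A hz').
    exists t' => //; exact: (act_det A) (act_mul A hz' ht') h1.
  + split=> /= [[z hz <-]|<-]; first by rewrite (act_one A hz).
    by have [z hz] := tot x s; exists x => //; rewrite -{2}(act_one A hz).
- move=> /(_ x0 x0)[_ /(_ erefl)] /= [z hz ez].
  by apply: c1; apply: (act_free A (x := x0) (s := true)); rewrite -{2}ez.
- move=> i /rel_rotated hi x y; split=> [h|e]; first exact: (run_det A) (cl x _ hi) h.
  by case: _ / (e : x = y); exact: cl.
Qed.

(** The quotient by a maximal congruence that does not kill [k].  A normal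
subgroup [N] with a nontrivial element gives a strictly larger congruence [E'],
which kills [k] by maximality, and then everything by [model_kill]; so [N] is
the whole group.  If two elements of one copy of [Gam] were identified, their
quotient would die, and [k] with it. *)
Theorem simple_quotient : exists (S : groupType) (io : letter Gam -> S),
  [/\ simple_group S,
      forall s a b, io (s, a * b)%g = (io (s, a) * io (s, b))%g,
      forall s, injective (fun a => io (s, a)) &
      forall s x b1 b2 (H : set S), x <> 1%g -> b1 <> 1%g -> b2 <> 1%g -> b1 <> b2 ->
        subgroup H -> H (io (s, x)) -> H (io (~~ s, b1)) -> H (io (~~ s, b2)) ->
        H = [set: S]].
Proof.
have [E0 [cE0 nE0 relE0]] := base_cong.
have [E [cE sE nE Emax]] := max_cong cE0 nE0.
have modelE E' (cE' : cong E') : (forall u v, E0 u v -> E' u v) ->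
    @model L Gam code (quot cE') (fun l => cls cE' [:: l]).
  move=> sE'; split=> [s a b|i vi].
    by rewrite clsM; apply/cls_eq; apply: (cong_sym cE'); exact: (cong_mul cE').
  by rewrite -cls_prod; apply/cls_eq; apply: sE'; exact: relE0.
have M := modelE E cE sE.
pose io l := cls cE [:: l].
have all_cls (H : set (quot cE)) : subgroup H -> (forall l, H (io l)) -> H = [set: quot cE].
  move=> sH hl; apply/seteqP; split=> // x _; rewrite -(repK x) cls_prod.
  apply: (big_ind H) => [|y z hy hz|l _]; [|exact: subgroupM|exact: hl].
  by have /subgroupP[] := sH.
exists (quot cE), io; split.
- split.
    move=> e; apply: nE; apply/(cls_eq cE).
    have h : [set 1%g : quot cE] (io k) by rewrite -e.
    exact: h.
  move=> N [sN nN]; case: (pselect (exists2 x, N x & x <> 1%g)) => [[x Nx x1]|h]; last first.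
    left; apply/seteqP; split=> x /=.
      by move=> Nx; apply: contrapT => x1; apply: h; exists x.
    by move=> ->; have /subgroupP[] := sN.
  right; pose E' u v := N (cls cE u * (cls cE v)^-1)%g.
  have N1 : N 1%g by have /subgroupP[] := sN.
  have EE' u v : E u v -> E' u v.
    by move=> h; rewrite /E' (_ : cls cE u = cls cE v) ?mulgV //; apply/cls_eq.
  have cE' : cong E'.
    split=> [u|u v h|u v w h1 h2|u u' v v' h1 h2|s a b|s].
    + by rewrite /E' mulgV.
    + by have := subgroupV sN h; rewrite invgM invgK.
    + by have := subgroupM sN h1 h2; rewrite mulgA mulgVK.
    + have := subgroupM sN (nN _ (cls cE u)^-1%g h2) h1.
      by rewrite /E' -!clsM conjgE invgK invgM !mulgA mulgVK.
    + by apply: EE'; exact: cong_mul.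
    + by apply: EE'; exact: cong_one.
  have E'k : E' [:: k] [::].
    apply: contrapT => nk; apply: x1; rewrite -(repK x); apply/cls_eq.
    apply: (Emax E' cE' EE' nk); rewrite /E' repK.
    by rewrite -[cls cE [::]]/(1%g : quot cE) invg1 mulg1.
  have M' := modelE E' cE' (fun u v h => EE' u v (sE u v h)).
  have kill := model_kill L_big M' c1 (_ : cls cE' [:: (true, c)] = 1%g) c1 c3 d1 d5.
  apply: all_cls => // l; have /cls_eq : cls cE' [:: l] = cls cE' [::].
    by apply: kill; apply/cls_eq.
  by rewrite /E' -[cls cE [::]]/(1%g : quot cE) invg1 mulg1.
- by move=> s a b; exact: (io_mul M).
- move=> s a b e; apply: contrapT => ab; apply: nE; apply/(cls_eq cE).
  apply: (model_kill L_big M (x := (a * b^-1)%g) (s := s)) c1 c3 d1 d5 _.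
    by move=> e1; apply: ab; rewrite -[a](mulgVK b) e1 mul1g.
  by rewrite (io_mul M) (homV (io_mul M s)) -[cls cE [:: (s, a)]]/(io (s, a)) e mulgV.
- move=> s x b1 b2 H x1 b11 b21 b12 sH h1 h2 h3; apply: all_cls => //.
  by move=> l; apply: (model_gen L_big M x1 b11 b21 b12 sH h1 h2 h3).
Qed.
End Simple.

(** * Elements of every order, and the embedding *)
Section NonzeroAlgebraic.
Import GRing.Theory Num.Theory.
Local Open Scope ring_scope.

(** Any countable group with elements of every order would do; here roots of
unity give the finite orders and 2 the infinite one. *)
Definition nzalg : Type := {x : algC | x != 0}.
HB.instance Definition _ := Countable.on nzalg.

Definition nz_one : nzalg := exist _ 1 (oner_neq0 _).
Definition nz_mul (x y : nzalg) : nzalg :=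
  exist _ (val x * val y) (mulf_neq0 (valP x) (valP y)).
Definition nz_inv (x : nzalg) : nzalg := exist _ (val x)^-1 (invr_neq0 (valP x)).

Fact nz_mulA : associative nz_mul.
Proof. by move=> x y z; apply: val_inj; rewrite /= mulrA. Qed.
Fact nz_mul1 : left_id nz_one nz_mul.
Proof. by move=> x; apply: val_inj; rewrite /= mul1r. Qed.
Fact nz_mulr1 : right_id nz_one nz_mul.
Proof. by move=> x; apply: val_inj; rewrite /= mulr1. Qed.
Fact nz_mulV : left_inverse nz_one nz_inv nz_mul.
Proof. by move=> x; apply: val_inj; rewrite /= mulVf // (valP x). Qed.
Fact nz_mulrV : right_inverse nz_one nz_inv nz_mul.
Proof. by move=> x; apply: val_inj; rewrite /= mulfV // (valP x). Qed.

HB.instance Definition _ := isGroup.Build nzalg nz_mulA nz_mul1 nz_mulr1 nz_mulV nz_mulrV.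

Lemma val_nzX (x : nzalg) n : val (x ^+ n)%g = val x ^+ n.
Proof. by elim: n => // n IH; rewrite expgS exprS -IH. Qed.

Lemma nzalg_order p : ext_ge p 1 -> exists x : nzalg, has_order x p.
Proof.
case: p => [n|_] /=.
  move=> n0; have [z hz] := C_prim_root_exists n0.
  have z0 : z != 0.
    apply/eqP => z0; have := prim_expr_order hz; rewrite z0 expr0n gtn_eqF //.
    by move/eqP; rewrite eq_sym oner_eq0.
  exists (exist _ z z0); split=> //; first by apply: val_inj; rewrite val_nzX prim_expr_order.
  move=> m /andP[m0 mn] /(congr1 val); rewrite val_nzX => /eqP.
  by rewrite -(prim_order_dvd hz) gtnNdvd.
have n0 : (2%:R : algC) != 0 by rewrite pnatr_eq0.
exists (exist _ 2%:R n0) => m m0 /(congr1 val); rewrite val_nzX /= -natrX => /eqP.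
by rewrite pnatr_eq1 => /eqP; have := ltn_expl m (isT : 1 < 2)%N; lia.
Qed.
End NonzeroAlgebraic.

Local Open Scope group_scope.
Local Open Scope classical_set_scope.
Local Open Scope card_scope.

Lemma has_order_neq1 (G : groupType) (x : G) p m :
  has_order x p -> ext_ge p m.+1 -> (0 < m)%N -> x ^+ m <> 1.
Proof.
case: p => [n|] /=; last by move=> h _; exact: h.
by move=> [_ _ h] mn m0; apply: h; rewrite m0.
Qed.

Lemma ext_ge_le p m n : (m <= n)%N -> ext_ge p n -> ext_ge p m.
Proof. by case: p => //= k mn; exact: leq_trans. Qed.

Lemma three_elements (G : groupType) : `I_3 #<= [set: G] ->
  exists a b : G, [/\ a <> 1, b <> 1 & a <> b].
Proof.
pose pG : pointedType := HB.pack (Group.sort G) (isPointed.Build G 1).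
move=> /(@pcard_leTP _ pG)[f].
have fI i j : (i < 3)%N -> (j < 3)%N -> f i = f j -> i = j.
  by move=> hi hj; apply: inj; rewrite inE.
exists ((f 0%N)^-1 * f 1%N), ((f 0%N)^-1 * f 2); split.
- by move=> e; have /(fI 0%N 1%N isT isT) : f 0%N = f 1%N by apply: (mulgI (f 0%N)^-1);
  rewrite e mulVg.
- by move=> e; have /(fI 0%N 2 isT isT) : f 0%N = f 2 by apply: (mulgI (f 0%N)^-1); rewrite e mulVg.
- by move=> /mulgI /(fI 1%N 2 isT isT).
Qed.

Theorem corollaryA (G : groupType) (countG : countable [set: G]) :
  exists (S : groupType) (phi : {multiplicative G -> S}),
    [/\ simple_group S,
        injective phi,
        forall p q : ext_order, ext_ge p 2 -> ext_ge q 3 ->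
          exists x y : S,
            [/\ has_order x p, has_order y q & generated [set x; y] = [set: S]]
      & `I_3 #<= [set: G] ->
        forall p : ext_order, ext_ge p 2 ->
          exists z : S,
            has_order z p /\ generated (range phi `|` [set z]) = [set: S]].
Proof.
have /countable_injP[f fI] := countG.
have {}fI : injective f by move=> x y; apply: fI; rewrite inE.
pose Gam : groupType := (G * nzalg)%type.
pose fG (x : Gam) : nat := pickle (f x.1, pickle x.2).
have fGI : injective fG.
  move=> [x1 x2] [y1 y2] /(pcan_inj pickleK)[/fI -> e].
  by rewrite (pcan_inj pickleK e).
pose code (i : rel_index Gam) : nat :=
  pickle (rs i, fG (rx i), fG (rb1 i), fG (rb2 i), ((rg i).1, fG (rg i).2)).
have codeI : injective code.
  move=> [s x b1 b2 [t g]] [s' x' b1' b2' [t' g']] /(pcan_inj pickleK) /= [].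
  by move=> -> /fGI-> /fGI-> /fGI-> -> /fGI->.
have inK_M (x y : nzalg) : ((1, x * y) : Gam) = (1, x) * (1, y).
  by congr pair; rewrite mulg1.
have inKI : injective (fun x : nzalg => (1, x) : Gam) by move=> x y [].
have inG_M (x y : G) : ((x * y, 1) : Gam) = (x, 1) * (y, 1).
  by congr pair; rewrite mulg1.
have inGI : injective (fun x : G => (x, 1) : Gam) by move=> x y [].
have [c hc] := nzalg_order (p := Some 3) isT.
have [d hd] := nzalg_order (p := Some 5) isT.
have oK x p : has_order x p -> has_order ((1, x) : Gam) p := hom_order inK_M inKI.
have hc1 := has_order_neq1 (m := 1) (oK _ _ hc) isT isT.
have hd1 := has_order_neq1 (m := 1) (oK _ _ hd) isT isT.
have [_ hc3 _] := oK _ _ hc; have [_ hd5 _] := oK _ _ hd.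
have [S [io [simpleS ioM ioI ioH]]] :=
  simple_quotient (leqnn (32 * 64)) codeI hc1 hc3 hd1 hd5.
pose ph (g : G) : S := io (false, (g, 1)).
have phM (x y : G) : ph (x * y) = ph x * ph y by rewrite /ph inG_M ioM.
pose phi : {multiplicative G -> S} := HB.pack ph (isMultiplicative.Build G S ph phM).
have order_io s x p : has_order x p -> has_order (io (s, (1, x))) p.
  by move=> h; apply: (hom_order (ioM s) (ioI s)); exact: oK.
exists S, phi; split=> //.
- by move=> x y /ioI/inGI.
- move=> p q hp hq.
  have hq2 := @ext_ge_le q 2 3 isT hq.
  have [x hx] := nzalg_order (@ext_ge_le p 1 2 isT hp).
  have [y hy] := nzalg_order (@ext_ge_le q 1 3 isT hq).
  have y1 := has_order_neq1 (m := 1) (oK _ _ hy) hq2 isT.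
  have y2 := has_order_neq1 (m := 2) (oK _ _ hy) hq isT.
  exists (io (true, (1, x))), (io (false, (1, y))); split; try exact: order_io.
  apply: (ioH true (1, x) (1, y) ((1, y) ^+ 2)).
  + exact: (has_order_neq1 (m := 1) (oK _ _ hx) hp isT).
  + exact: y1.
  + exact: y2.
  + by move=> e; apply: y1; apply: (mulgI (1, y)); rewrite mulg1 -[LHS]expg2 -e.
  + exact: generated_subgroup.
  + by apply: generated_sub; left.
  + by apply: generated_sub; right.
  + by rewrite expg2 ioM; apply: (subgroupM (generated_subgroup _));
      apply: generated_sub; right.
- move=> /three_elements[a [b [a1 b1 ab]]] p hp.
  have [x hx] := nzalg_order (@ext_ge_le p 1 2 isT hp).
  exists (io (true, (1, x))); split; first exact: order_io.
  apply: (ioH true (1, x) (a, 1) (b, 1)).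
  + exact: (has_order_neq1 (m := 1) (oK _ _ hx) hp isT).
  + by case.
  + by case.
  + by case.
  + exact: generated_subgroup.
  + by apply: generated_sub; right.
  + by apply: generated_sub; left; exists a.
  + by apply: generated_sub; left; exists b.
Qed.
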